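(* Let $G$ be a finite group with identity $e$, and let $X\in M_{|G|}(\mathcal A)$ be free from $M_{|G|}(\mathbb C)$ with respect to $\varphi$ (freeness over $\mathbb C$). Let $$X^t=\sum_{g\in G}Y_g$$ be the left $G$-circulant decomposition of the transpose $X^t$. Then the family consisting of the set $\{Y_e\}$ together with the sets $\{Y_g,Y_{g^{-1}}\}$, one for each distinct subset $\{g,g^{-1}\}$ with $g\in G\setminus\{e\}$, is free (over $\mathbb C$) in $(M_{|G|}(\mathcal A),\varphi)$. Moreover, for every $g\in G\setminus\{e\}$, $\{Y_g,Y_{g^{-1}}\}$ is an $R$-diagonal pair.
   Context: $(\mathcal A,\tau)$ is a $*$-probability space: a unital complex $*$-algebra with a linear functional $\tau$ such that $\tau(1)=1$. $M_{|G|}(\mathcal A)$ is equipped with $\varphi(A)=\frac1{|G|}\sum_{h\in G}\tau(A_{h,h})$, and $M_{|G|}(\mathbb C)\subset M_{|G|}(\mathcal A)$ via $\mathbb C\cdot 1\subset\mathcal A$. Rows and columns of matrices are indexed by the elements of $G$ through a fixed enumeration of $G$ starting with $e$. Transpose: $(X^t)_{p,q}=X_{q,p}$ (entries of $\mathcal A$ are unchanged). Left $G$-circulant decomposition: for $A\in M_{|G|}(\mathcal A)$ and $g\in G$, let $A_g$ be the matrix with $(A_g)_{p,q}=A_{p,q}$ if $q=gp$ and $(A_g)_{p,q}=0$ otherwise; then $A=\sum_{g\in G}A_g$. So $(Y_g)_{p,q}=X_{q,p}$ if $q=gp$ and $0$ otherwise. Freeness: unital subalgebras $(\mathcal A_i)_{i\in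 I}$ are free if $\varphi\big((a_1-\varphi(a_1)1)\cdots(a_n-\varphi(a_n)1)\big)=0$ whenever $a_j\in\mathcal A_{i(j)}$ and $i(1)\ne i(2)\ne\cdots\ne i(n)$ (consecutive indices distinct). Sets of elements are free if the unital algebras they generate are free. Free cumulants $\kappa_n$ of $\varphi$ are the multilinear functionals defined by $\varphi(a_1\cdots a_n)=\sum_{\pi\in \mathcal{NC}(n)}\prod_{V\in\pi}\kappa_{|V|}\big((a_1,\dots,a_n)|_V\big)$, where $\mathcal{NC}(n)$ is the set of non-crossing partitions of $\{1,\dots,n\}$. $R$-diagonal pair: for $a\neq b$, $\{a,b\}$ is an $R$-diagonal pair if, for all $n\ge1$ and $c_1,\dots,c_n\in\{a,b\}$, $\kappa_n(c_1,\dots,c_n)=0$ unless $n$ is even and the arguments alternate, i.e. $c_i\ne c_{i+1}$ for all $1\le i<n$. (If $X$ is self-adjoint then $Y_{g^{-1}}=Y_g^*$ and this is the usual notion for $\{a,a^*\}$.) In the degenerate case $g=g^{-1}$, so that the two elements of the pair coincide, the condition is understood as: $\kappa_n(Y_g,\dots,Y_g)=0$ for all odd $n$. (In the case $g\ne g^{-1}$ the condition is understood for the pair of labelled variables $a=Y_g$, $b=Y_{g^{-1}}$, the alternation referring to the labels.) *)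

(* Defs.v *)
From HB Require Import structures.
From mathcomp Require Import all_boot all_order all_algebra all_fingroup.

Set Implicit Arguments.
Unset Strict Implicit.
Unset Printing Implicit Defensive.

Import Order.TTheory GRing.Theory Num.Theory.
Local Open Scope ring_scope.

Section StarAlgebra.
Variables (C : numClosedFieldType) (A : algType C).

Definition star_operation (star : A -> A) : Prop :=
  [/\ involutive star,
      forall a b, star (a + b) = star a + star b,
      forall (c : C) a, star (c *: a) = c^* *: star a
    & forall a b, star (a * b) = star b * star a].

End StarAlgebra.

(* The library only makes 'M[A]_n.+1 a module over A; this alias carries the  *)
(* algebra structure over the base field K instead. The ring structure is the *)
(* library's.                                                                 *)
Definition matrix_algebra (K : nzRingType) (A : algType K) (n : nat) : Type :=
  'M[A]_n.+1.

HB.instance Definition _ (K : nzRingType) (A : algType K) (n : nat) :=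
  GRing.NzRing.copy (matrix_algebra A n) 'M[A]_n.+1.

Section MatrixAlgebra.
Variables (K : nzRingType) (A : algType K) (n : nat).
Local Notation MA := (matrix_algebra A n).

Definition matrix_algebra_scale (c : K) (X : MA) : MA :=
  map_mx (fun a : A => c *: a) X.

Fact matrix_algebra_scaleA c d X :
  matrix_algebra_scale c (matrix_algebra_scale d X) =
  matrix_algebra_scale (c * d) X.
Proof. by apply/matrixP => i j; rewrite !mxE scalerA. Qed.

Fact matrix_algebra_scale1 : left_id 1 matrix_algebra_scale.
Proof. by move=> X; apply/matrixP => i j; rewrite !mxE scale1r. Qed.

Fact matrix_algebra_scaleDr : right_distributive matrix_algebra_scale +%R.
Proof. by move=> c X Y; apply/matrixP => i j; rewrite !mxE scalerDr. Qed.

Fact matrix_algebra_scaleDl X :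
  {morph matrix_algebra_scale^~ X : c d / c + d}.
Proof. by move=> c d; apply/matrixP => i j; rewrite !mxE scalerDl. Qed.

HB.instance Definition _ := GRing.Zmodule_isLmodule.Build K MA
  matrix_algebra_scaleA matrix_algebra_scale1
  matrix_algebra_scaleDr matrix_algebra_scaleDl.

Fact matrix_algebra_scaleAl (c : K) (X Y : MA) : c *: (X * Y) = (c *: X) * Y.
Proof.
apply/matrixP => i j; rewrite !mxE scaler_sumr.
by apply: eq_bigr => k _; rewrite !mxE scalerAl.
Qed.

HB.instance Definition _ :=
  GRing.Lmodule_isLalgebra.Build K MA matrix_algebra_scaleAl.

Fact matrix_algebra_scaleAr (c : K) (X Y : MA) : c *: (X * Y) = X * (c *: Y).
Proof.
apply/matrixP => i j; rewrite !mxE scaler_sumr.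
by apply: eq_bigr => k _; rewrite !mxE scalerAr.
Qed.

HB.instance Definition _ :=
  GRing.Lalgebra_isAlgebra.Build K MA matrix_algebra_scaleAr.

End MatrixAlgebra.

Section NormalizedTrace.
Variables (K : fieldType) (A : algType K) (n : nat).
Local Notation MA := (matrix_algebra A n).

Definition normalized_trace (tau : A -> K) (X : MA) : K :=
  n.+1%:R^-1 * \sum_(i < n.+1) tau (X i i).

Fact normalized_trace_linear (tau : {scalar A}) :
  scalar (normalized_trace tau).
Proof.
move=> c X Y; rewrite /normalized_trace mulrCA -mulrDr; congr (_ * _).
rewrite mulr_sumr -big_split /=; apply: eq_bigr => i _.
by rewrite !mxE linearP.
Qed.

HB.instance Definition _ (tau : {scalar A}) :=
  GRing.isLinear.Build K MA K *%R (normalized_trace tau)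
    (normalized_trace_linear tau).

End NormalizedTrace.

Definition noncrossing n (P : {set {set 'I_n}}) : bool :=
  [forall V in P, forall W in P, (V != W) ==>
    [forall i in V, forall j in W, forall k in V, forall l in W,
      ~~ [&& i < j, j < k & k < l]%N]].

Definition noncrossing_partitions n : {set {set {set 'I_n}}} :=
  [set P | partition P [set: 'I_n] & noncrossing P].

Section Cumulants.
Variables (K : fieldType) (B : algType K).

(* (a_1, ..., a_n)|_V in increasing order of the positions, which start at 0. *)
Definition subword n (s : seq B) (V : {set 'I_n}) : seq B :=
  [seq s`_(i : 'I_n) | i <- enum V].

Definition multilinear (kappa : seq B -> K) : Prop :=
  forall (s1 s2 : seq B) (c : K) (x y : B),
    kappa (s1 ++ (c *: x + y) :: s2) =
    c * kappa (s1 ++ x :: s2) + kappa (s1 ++ y :: s2).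

(* kappa s stands for kappa_n(a_1, ..., a_n) with s = [:: a_1; ...; a_n].     *)
Definition are_free_cumulants (phi : B -> K) (kappa : seq B -> K) : Prop :=
  multilinear kappa /\
  forall s : seq B, s != [::] ->
    phi (\prod_(x <- s) x) =
    \sum_(P in noncrossing_partitions (size s))
      \prod_(V in P) kappa (subword s V).

(* The moment-cumulant formula solved for the term of the one-block           *)
(* partition; m is a bound on the recursion depth. free_cumulantsP and        *)
(* free_cumulants_unique below show that this is the only solution.           *)
Fixpoint free_cumulant_rec (phi : B -> K) (m : nat) (s : seq B) : K :=
  if m is m'.+1 then
    phi (\prod_(x <- s) x) -
    \sum_(P in noncrossing_partitions (size s) | P != [set setT])
      \prod_(V in P) free_cumulant_rec phi m' (subword s V)
  else 0.

Definition free_cumulant (phi : B -> K) (s : seq B) : K :=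
  free_cumulant_rec phi (size s) s.

(* The two elements are labelled by booleans, so that a and b may coincide in *)
(* value: alternation refers to the labels.                                   *)
Definition R_diagonal_pair (phi : B -> K) (a b : B) : Prop :=
  forall w : seq bool, w != [::] ->
    ~~ (~~ odd (size w) && sorted (fun l l' => l != l') w) ->
    free_cumulant phi [seq (if l then a else b) | l <- w] = 0.

Definition odd_cumulants_vanish (phi : B -> K) (a : B) : Prop :=
  forall n : nat, odd n -> free_cumulant phi (nseq n a) = 0.

Lemma size_subword n (s : seq B) (V : {set 'I_n}) : size (subword s V) = #|V|.
Proof. by rewrite size_map -cardE. Qed.

Lemma subwordT n (s : seq B) : size s = n -> subword s [set: 'I_n] = s.
Proof.
move=> sn; apply: (@eq_from_nth _ 0); first by rewrite size_subword cardsT card_ord.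
rewrite size_subword cardsT card_ord => k kn.
rewrite /subword enum_setT -enumT (nth_map (Ordinal kn)) ?size_enum_ord //.
by rewrite nth_enum_ord.
Qed.

Lemma partition_block_lt n (P : {set {set 'I_n}}) V :
  partition P [set: 'I_n] -> P != [set setT] -> V \in P -> (#|V| < n)%N.
Proof.
move=> partP PT VP; have := max_card V; rewrite card_ord leq_eqVlt.
case/orP => // /eqP Vn.
have VT : V = setT.
  by apply/eqP; rewrite eqEcard subsetT cardsT card_ord Vn leqnn.
case/and3P: (partP) => _ trivP P0; case/negP: PT; apply/eqP/setP => W.
rewrite inE; apply/idP/eqP => [WP|->]; last by rewrite -VT.
apply/eqP; case: (eqVneq W setT) => // WT.
have := trivIsetP trivP W V WP VP; rewrite VT => /(_ WT).
rewrite -setI_eq0 setIT => /eqP W0.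
by rewrite W0 in WP; rewrite WP in P0.
Qed.

Lemma partition_block_gt0 n (P : {set {set 'I_n}}) V :
  partition P [set: 'I_n] -> V \in P -> (0 < #|V|)%N.
Proof.
case/and3P=> _ _ P0 VP; rewrite card_gt0; apply: contra P0 => /eqP <-.
exact: VP.
Qed.

Lemma free_cumulant_rec_fuel phi m s : (size s <= m)%N -> s != [::] ->
  free_cumulant_rec phi m s = free_cumulant phi s.
Proof.
rewrite /free_cumulant; move: {2}(size s) (leqnn (size s)) => k.
elim: k m s => [|k IH] [|m] [|x s] //= sk sm _; congr (_ - _).
apply: eq_bigr => P /andP[]; rewrite inE => /andP[partP _] PT.
apply: eq_bigr => V VP.
have Vlt := partition_block_lt partP PT VP.
have Vgt := partition_block_gt0 partP VP.
have Vnil : subword (x :: s) V != [::] by rewrite -size_eq0 size_subword -lt0n.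
have Vs : (#|V| <= size s)%N by [].
rewrite IH // ?size_subword; last 2 first.
- exact: leq_trans Vs sk.
- exact: leq_trans Vs sm.
by rewrite [RHS]IH // size_subword //; exact: leq_trans Vs sk.
Qed.

Lemma one_block_noncrossing n :
  [set [set: 'I_n.+1]] \in noncrossing_partitions n.+1.
Proof.
rewrite inE; apply/andP; split.
  rewrite /partition /cover big_set1 eqxx trivIset1 /= inE eq_sym -card_gt0.
  by rewrite cardsT card_ord.
apply/forall_inP => V; rewrite inE => /eqP->.
by apply/forall_inP => W; rewrite inE => /eqP->; rewrite eqxx.
Qed.

Lemma free_cumulantE phi s : s != [::] ->
  free_cumulant phi s = phi (\prod_(x <- s) x) -
    \sum_(P in noncrossing_partitions (size s) | P != [set setT])
      \prod_(V in P) free_cumulant phi (subword s V).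
Proof.
case: s => // x s _; rewrite {1}/free_cumulant /=; congr (_ - _).
apply: eq_bigr => P /andP[]; rewrite inE => /andP[partP _] PT.
apply: eq_bigr => V VP; apply: free_cumulant_rec_fuel.
  by rewrite size_subword -ltnS; exact: partition_block_lt partP PT VP.
by rewrite -size_eq0 size_subword -lt0n; exact: partition_block_gt0 partP VP.
Qed.

Lemma moment_cumulant_split (kappa : seq B -> K) s : s != [::] ->
  \sum_(P in noncrossing_partitions (size s))
    \prod_(V in P) kappa (subword s V) =
  kappa s + \sum_(P in noncrossing_partitions (size s) | P != [set setT])
      \prod_(V in P) kappa (subword s V).
Proof.
case: s => // x s _; rewrite (bigD1 [set setT]) ?one_block_noncrossing //=.
by rewrite big_set1 (@subwordT (size s).+1).
Qed.

Lemma free_cumulant_multilinear (phi : {scalar B}) :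
  multilinear (free_cumulant phi).
Proof.
move=> s1 s2 c x y.
have [k] := ubnP (size (s1 ++ x :: s2)).
elim: k s1 s2 => // k IH s1 s2 sk.
set n := size (s1 ++ x :: s2).
have sizeE z : size (s1 ++ z :: s2) = n by rewrite /n !size_cat.
have ltn1 : (size s1 < n)%N by rewrite /n size_cat /= addnS ltnS leq_addr.
pose i0 := Ordinal ltn1.
have nnil z : s1 ++ z :: s2 != [::] by case: (s1).
rewrite !free_cumulantE //.
have big_split3 z : \prod_(t <- s1 ++ z :: s2) t =
  \prod_(t <- s1) t * z * \prod_(t <- s2) t.
  by rewrite big_cat big_cons /= mulrA.
rewrite !big_split3 mulrDr mulrDl -scalerAr -scalerAl linearP /=.
rewrite !sizeE; rewrite mulrBr mulr_sumr [in RHS]addrACA -opprD -big_split /=.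
congr (_ - _); apply: eq_bigr => P /andP[]; rewrite inE => /andP[partP _] PT.
case/and3P: (partP) => /eqP covP trivP _.
have i0P : i0 \in cover P by rewrite covP inE.
have VP : pblock P i0 \in P by exact: pblock_mem.
have i0V : i0 \in pblock P i0 by rewrite mem_pblock.
pose f z (e : seq 'I_n) := [seq (s1 ++ z :: s2)`_(j : 'I_n) | j <- e].
have fE z (e : seq 'I_n) : i0 \notin e -> f z e = f x e.
  move=> ie; apply/eq_in_map => j je.
  have jn : val j != size s1.
    by apply: contra ie => /eqP ji; rewrite (_ : i0 = j) //; apply: val_inj.
  rewrite !nth_cat; case: (ltngtP (val j) (size s1)) jn => // lt _.
  by rewrite -(subnSK lt).
have outE (W : {set 'I_n}) z : i0 \notin W ->
    subword (s1 ++ z :: s2) W = subword (s1 ++ x :: s2) W.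
  by move=> iW; apply: fE; rewrite mem_enum.
have [t1 [t2 tE]] : exists t1 t2, forall z,
    subword (s1 ++ z :: s2) (pblock P i0) = t1 ++ z :: t2.
  have := i0V; rewrite -mem_enum => iE.
  have [e1 [e2 eE]] : exists e1 e2, enum (pblock P i0) = e1 ++ i0 :: e2.
    by case/splitPr: iE => e1 e2; exists e1, e2.
  have := enum_uniq (mem (pblock P i0)); rewrite eE cat_uniq /= negb_or.
  case/and3P=> _ /andP[i1 _] /andP[i2 _].
  exists (f x e1), (f x e2) => z; rewrite /subword eE map_cat /=.
  by rewrite nth_cat ltnn subnn /= -(fE z e1) // -(fE z e2).
have szt : (size (t1 ++ x :: t2) < k)%N.
  rewrite -tE size_subword; apply: leq_trans (_ : n <= k)%N => //.
  exact: partition_block_lt partP PT VP.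
rewrite !(bigD1 (pblock P i0) VP) /= !tE IH // mulrDl mulrA.
have rest z : \prod_(W in P | W != pblock P i0)
      free_cumulant phi (subword (s1 ++ z :: s2) W) =
    \prod_(W in P | W != pblock P i0)
      free_cumulant phi (subword (s1 ++ x :: s2) W).
  apply: eq_bigr => W /andP[WP WV]; rewrite outE //.
  by apply: contra WV => iW; rewrite (def_pblock trivP WP iW).
by rewrite (rest y) (rest (c *: x + y)).
Qed.

Lemma free_cumulantsP (phi : {scalar B}) :
  are_free_cumulants phi (free_cumulant phi).
Proof.
split=> [|s s0]; first exact: free_cumulant_multilinear.
by rewrite moment_cumulant_split // {1}free_cumulantE // subrK.
Qed.

Lemma free_cumulants_unique (phi : B -> K) (kappa : seq B -> K) :
  are_free_cumulants phi kappa ->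
  forall s, s != [::] -> kappa s = free_cumulant phi s.
Proof.
case=> _ kE s; have [k] := ubnP (size s); elim: k s => // k IH s sk s0.
rewrite free_cumulantE // kE // moment_cumulant_split // -addrA.
rewrite -[LHS]addr0; congr (_ + _); apply/esym/eqP; rewrite subr_eq0; apply/eqP.
apply: eq_bigr => P /andP[]; rewrite inE => /andP[partP _] PT.
apply: eq_bigr => V VP; apply: IH; rewrite ?size_subword.
  by apply: leq_trans (partition_block_lt partP PT VP) _.
by rewrite -size_eq0 size_subword -lt0n; exact: partition_block_gt0 partP VP.
Qed.

End Cumulants.

(* The rows and columns of a matrix are indexed by the group elements through *)
(* the enumeration i |-> enumG i.                                             *)
Definition left_circulant (K : nzRingType) (A : algType K) (n : nat)
    (gT : finGroupType) (enumG : 'I_n.+1 -> gT)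
    (X : matrix_algebra A n) (g : gT) : matrix_algebra A n :=
  \matrix_(i, j) (if enumG j == (g * enumG i)%g then X i j else 0).

Lemma left_circulant_sum (K : nzRingType) (A : algType K) (n : nat)
    (gT : finGroupType) (enumG : 'I_n.+1 -> gT) (X : matrix_algebra A n) :
  X = \sum_(g : gT) left_circulant enumG X g.
Proof.
apply/matrixP => i j; rewrite summxE (bigD1 (enumG j * (enumG i)^-1)%g) //=.
rewrite mxE mulgKV eqxx big1 ?addr0 // => g gij; rewrite mxE; case: eqP => // ji.
by case/eqP: gij; rewrite ji mulgK.
Qed.

(* The set given by g = 1 is the singleton [set 1].                           *)
Definition inverse_pairs (gT : finGroupType) : {set {set gT}} :=
  [set [set g; g^-1]%g | g : gT].

(* classical_sets shadows names of finset (partition, setT), hence the late   *)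
(* import.                                                                    *)
From mathcomp Require Import classical_sets.

Definition base_field_matrices (K : nzRingType) (A : algType K) (n : nat) :
    set (matrix_algebra A n) :=
  range (fun M : 'M[K]_n.+1 => map_mx (in_alg A) M : matrix_algebra A n).
Arguments base_field_matrices {K} A n _.

Section Freeness.
Variables (K : fieldType) (B : algType K).
Local Open Scope classical_set_scope.

Definition unital_subalgebra (S : set B) : Prop :=
  [/\ S 1,
      forall x y, S x -> S y -> S (x + y),
      forall x y, S x -> S y -> S (x * y)
    & forall (c : K) x, S x -> S (c *: x)].

Definition generated_algebra (S : set B) : set B :=
  smallest unital_subalgebra S.

(* Only the values of i and a below n matter; \prod is the ordered product.   *)
Definition free_subalgebras (phi : B -> K) (I : Type) (S : I -> set B) : Prop :=
  forall (n : nat) (i : nat -> I) (a : nat -> B),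
    (0 < n)%N ->
    (forall j, (j < n)%N -> S (i j) (a j)) ->
    (forall j, (j.+1 < n)%N -> i j <> i j.+1) ->
    phi (\prod_(j < n) (a j - phi (a j) *: 1)) = 0.

Definition free_sets (phi : B -> K) (I : Type) (S : I -> set B) : Prop :=
  free_subalgebras phi (fun i => generated_algebra (S i)).

Definition free_from (phi : B -> K) (S T : set B) : Prop :=
  free_sets phi (fun b : bool => if b then S else T).

End Freeness.

(* Main.v *)
From HB Require Import structures.
Require Import Defs.
From mathcomp Require Import boolp classical_sets reals complex.
From mathcomp Require Import all_boot all_order all_algebra all_fingroup.
From mathcomp Require Import ring.

Set Implicit Arguments.
Unset Strict Implicit.
Unset Printing Implicit Defensive.

Import Order.TTheory GRing.Theory Num.Theory.
Local Open Scope ring_scope.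

(** Let N be the order of G and kappa the sequence of free cumulants of X.
    A product of entries of X along a path of vertices p, g_1 p, g_2 g_1 p, ...
    is a corner of a product of X with matrix units, so its expectation is
    determined by the freeness of X from the scalar matrices. Summing over p
    gives
      phi (Y_{g_1} ... Y_{g_m}) = sum over the noncrossing partitions of the
                                  positions of the product over the blocks of
                                  w (letters of the block),
    where w (h_1, ..., h_r) is N^(1-r) kappa_r if every letter is the inverse
    of its predecessor and h_r ... h_1 = 1, and 0 otherwise ([circ_moment]).
    Moments determine cumulants, so w is the free cumulant of the Y_g
    ([free_cumulant_of_moments]). It vanishes on every word that meets two
    different sets {g, g^-1}, and vanishing mixed cumulants give freeness
    ([free_of_moments]). An alternating word of odd length in g and g^-1 has
    product g or g^-1; for g != 1 this excludes the odd lengths, which is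
    R-diagonality.

    Sums over noncrossing partitions are evaluated by reading a word from left
    to right with a stack of open blocks. Each letter opens a block or joins
    the innermost open one, and then that block stays open or is closed, paying
    its weight ([moment_noncrossing]). A letter thereby becomes an operator on
    functions of stacks, as on a Fock space. Freeness is then visible on the
    operators: a letter of one color only acts on the top of the stack, as long
    as the blocks there have its color ([local_letter]).

    For X free from an algebra D of coefficients the stack also remembers
    coefficients: a block that is opened stores the coefficient read so far in
    the enclosing gap, and a gap between two consecutive elements of a block
    contributes the mean of its coefficient ([read_X]). That this computes the
    mixed moments ([mixed_moment]) holds because centered alternating products
    have mean zero in the scan as they have under phi, and every word reduces
    to those. With D the scalar matrices, all coefficients met along a path are
    matrix units, and the two scans run in parallel ([path_simulation]). *)

(** * Noncrossing partitions read from left to right *)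

Section NoncrossingScan.
Variable n : nat.
Implicit Types (V W B T : {set 'I_n}) (P : {set {set 'I_n}}) (st : seq {set 'I_n}).

Lemma noncrossingP P :
  reflect (forall V W (i j k l : 'I_n), V \in P -> W \in P -> V != W ->
             i \in V -> j \in W -> k \in V -> l \in W ->
             (i < j)%N -> (j < k)%N -> (k < l)%N -> False)
          (noncrossing P).
Proof.
apply: (iffP idP) => [ncP V W i j k l VP WP VW iV jW kV lW ij jk kl | ncP].
  move/forall_inP/(_ V VP)/forall_inP/(_ W WP)/implyP/(_ VW): ncP.
  move/forall_inP/(_ i iV)/forall_inP/(_ j jW).
  by move/forall_inP/(_ k kV)/forall_inP/(_ l lW); rewrite ij jk kl.
apply/forall_inP => V VP; apply/forall_inP => W WP; apply/implyP => VW.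
apply/forall_inP => i iV; apply/forall_inP => j jW.
apply/forall_inP => k kV; apply/forall_inP => l lW.
by apply/negP => /and3P[]; apply: (ncP V W).
Qed.

Definition past (k : nat) : {set 'I_n} := [set i : 'I_n | (i < k)%N].

Definition support st : {set 'I_n} := [set i | has (fun V => i \in V) st].

Lemma supportP st i :
  reflect (exists2 V, V \in st & i \in V) (i \in support st).
Proof. by rewrite inE; apply: hasP. Qed.

Lemma support_cons V st : support (V :: st) = V :|: support st.
Proof. by apply/setP => i; rewrite !inE. Qed.

(** At time k the closed blocks are forgotten: P is a partition of what remains,
    and [st] lists the parts below k of the blocks of P that are still to
    receive an element at k or later, the innermost block first. *)
Definition open_at (k : nat) P st :=
  [&& partition P (support st :|: ~: past k), noncrossing P &
      all (fun V => [exists B in P, (B :&: past k == V) && ~~ (B \subset past k)])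
          st].

Definition before W V := [forall i in W, forall j in V, (i < j)%N].

(** An outer block cannot grow while an inner one is open, so the part of it
    already read lies before everything in the inner block. *)
Definition nested (k : nat) st :=
  all (fun V => (V != set0) && (V \subset past k)) st &&
  pairwise (fun V W => before W V) st.

(** The empty set stands for a block that has no element yet, so that opening
    a block and joining the innermost one are a single case. *)
Definition push T st := if T == set0 then st else T :: st.

Lemma beforeP W V :
  reflect (forall i j, i \in W -> j \in V -> (i < j)%N) (before W V).
Proof.
apply: (iffP forall_inP) => [WV i j iW jV | WV i iW].
  by move/forall_inP: (WV i iW); apply.
by apply/forall_inP => j jV; apply: WV.
Qed.

Lemma block_eq P U V W i : partition P U -> V \in P -> W \in P ->
  i \in V -> i \in W -> V = W.
Proof.
move=> /partition_trivIset tP VP WP iV iW.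
by rewrite -(def_pblock tP VP iV) (def_pblock tP WP iW).
Qed.

Lemma trace_block k P st (B : {set 'I_n}) i : open_at k P st -> B \in P ->
  i \in B -> (i < k)%N -> B :&: past k \in st /\ ~~ (B \subset past k).
Proof.
case/and3P=> partP _ /allP stP BP iB ik.
have : i \in support st :|: ~: past k.
  by rewrite -(cover_partition partP); apply/bigcupP; exists B.
rewrite !inE ik orbF => /hasP[V Vst iV].
have /exists_inP[B' B'P /andP[/eqP defV notB']] := stP V Vst.
have -> : B = B'.
  apply: block_eq partP BP B'P iB _.
  by move: iV; rewrite -defV inE => /andP[].
by rewrite defV.
Qed.

Section Step.
Variables (k : nat) (kn : (k < n)%N) (T : {set 'I_n}) (st : seq {set 'I_n}).
Let x := Ordinal kn.
Hypothesis Tk : T \subset past k.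
Hypothesis nst : nested k st.
Hypothesis stT : {in st, forall W, before W T}.

Let st_sub W : W \in st -> W \subset past k.
Proof. by case/andP: nst => /allP st1 _ /st1 /andP[]. Qed.

Let st_neq0 W : W \in st -> W != set0.
Proof. by case/andP: nst => /allP st1 _ /st1 /andP[]. Qed.

Let st_neqT W : W \in st -> W != T.
Proof.
move=> Wst; apply/eqP => WT; case/set0Pn: (st_neq0 Wst) => i iW.
by have /beforeP/(_ i i iW) := stT Wst; rewrite -WT iW ltnn => /(_ isT).
Qed.

Let pastS : past k.+1 = x |: past k.
Proof. by apply/setP => i; rewrite !inE ltnS leq_eqVlt -val_eqE. Qed.

Let support_push : support (push T st) = T :|: support st.
Proof.
rewrite /push; case: eqP => [->|_]; first by rewrite set0U.
by rewrite support_cons.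
Qed.

Let split_support :
  support (push T st) :|: ~: past k =
  (x |: T) :|: (support st :|: ~: past k.+1).
Proof.
rewrite support_push pastS; apply/setP => i; rewrite !inE.
have [->|] := eqVneq i x; first by rewrite ltnn !orbT.
by rewrite /= -!orbA.
Qed.

Let support_disjoint : [disjoint x |: T & support st :|: ~: past k.+1].
Proof.
rewrite disjoint_subset; apply/subsetP => i.
rewrite pastS !inE negb_or negbK => /orP[/eqP->|iT].
  rewrite eqxx andbT; apply/negP => /hasP[W /st_sub/subsetP Wk /Wk].
  by rewrite inE ltnn.
have := subsetP Tk i iT; rewrite inE => ->; rewrite orbT andbT.
apply/negP => /hasP[W Wst iW].
by have /beforeP/(_ i i iW iT) := stT Wst; rewrite ltnn.
Qed.

Let x_cover P st' : partition P (support st' :|: ~: past k) ->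
  pblock P x \in P /\ x \in pblock P x.
Proof.
move=> partP; have xP : x \in cover P by rewrite (cover_partition partP) !inE ltnn orbT.
by rewrite mem_pblock pblock_mem.
Qed.

(** If the block of [x] has further elements, nothing leaves P: passing from k
    to k.+1 only enlarges the trace T of that block by [x]. *)
Lemma open_at_keep P :
  [&& open_at k P (push T st), pblock P x :&: past k == T &
      ~~ (pblock P x \subset past k.+1)] =
  open_at k.+1 P (x |: T :: st).
Proof.
have supE : support (x |: T :: st) :|: ~: past k.+1 = support (push T st) :|: ~: past k.
  by rewrite split_support support_cons setUA.
apply/and3P/idP => [[/and3P[partP ncP /allP stP] /eqP xT xnot]|].
  have [xP xx] := x_cover partP.
  apply/and3P; split; rewrite ?supE //=; apply/andP; split.
    by apply/exists_inP; exists (pblock P x) => //; rewrite xnot andbT pastS setIUr xT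
       (setIidPr _) // sub1set.
  apply/allP => W Wst.
  have /stP/exists_inP[B BP /andP[/eqP defW notB]] : W \in push T st.
    by rewrite /push; case: ifP => // _; rewrite inE Wst orbT.
  have xB : x \notin B.
    apply/negP => xB; have BE := block_eq partP BP xP xB xx.
    by move: (st_neqT Wst); rewrite -defW BE xT eqxx.
  apply/exists_inP; exists B => //; rewrite pastS setIUr defW.
  have -> : B :&: [set x] = set0.
    apply/setP => i; rewrite !inE; apply/negP => /andP[iB /eqP ix].
    by rewrite -ix iB in xB.
  rewrite set0U eqxx /=; apply: contra notB => /subsetP BS; apply/subsetP => i iB.
  have := BS i iB; rewrite !inE => /orP[/eqP ix|//]; by rewrite -ix iB in xB.
case/and3P; rewrite supE => partP ncP /= /andP[/exists_inP[B BP]].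
move=> /andP[/eqP xT notB] /allP stP.
have xB : x \in B.
  have : x \in B :&: past k.+1 by rewrite xT !inE eqxx.
  by rewrite inE => /andP[].
have [xP xx] := x_cover partP.
have defB : pblock P x = B by apply: def_pblock => //; apply: partition_trivIset partP.
have sub_past C : C :&: past k = (C :&: past k.+1) :&: past k.
  by rewrite -setIA; congr (_ :&: _); apply/esym/setIidPr; rewrite pastS subsetUr.
have xp : [set x] :&: past k = set0.
  by apply/setP => i; rewrite !inE; apply/negP => /andP[/eqP->]; rewrite ltnn.
have traceB : B :&: past k = T.
  by rewrite sub_past xT setIUl xp set0U; apply/setIidPl.
have notk (C : {set _}) : ~~ (C \subset past k.+1) -> ~~ (C \subset past k).
  by apply: contra => CS; apply: subset_trans CS _; rewrite pastS subsetUr.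
split; rewrite ?defB ?traceB //.
apply/and3P; split=> //; apply/allP => W; rewrite /push => Wst.
have {Wst} : W = T \/ W \in st.
  by move: Wst; case: ifP => _; rewrite ?inE; [right|case/orP => [/eqP|]; auto].
case=> [->|Wst]; apply/exists_inP.
  by exists B => //; rewrite traceB eqxx notk.
have /exists_inP[C CP /andP[/eqP defW notC]] := stP W Wst.
by exists C => //; rewrite sub_past defW notk // andbT; apply/eqP/setIidPl/st_sub.
Qed.

(** The remaining elements lie after [x], or in outer open blocks and hence
    before all of T; no block can therefore cross [x |: T], and adding or
    removing this block preserves being noncrossing. *)
Lemma open_at_close P : x |: T \notin P ->
  open_at k (x |: T |: P) (push T st) = open_at k.+1 P st.
Proof.
move=> xTP.
have xT0 : x |: T != set0 by apply/set0Pn; exists x; rewrite !inE eqxx.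
have partE : partition (x |: T |: P) (support (push T st) :|: ~: past k) =
             partition P (support st :|: ~: past k.+1).
  rewrite split_support; apply/idP/idP => [partP|partP]; last exact: partitionU1.
  have := partitionD1 partP (setU11 _ _); rewrite setU1K //.
  rewrite setDUl setDv set0U; congr (partition _ _).
  by apply/setDidPl; rewrite disjoint_sym.
rewrite /open_at partE.
apply/and3P/and3P => [[partP ncP /allP stP]|[partP ncP /allP stP]].
  split=> //.
    apply/noncrossingP => V W i j k' l VP WP.
    by move/noncrossingP: ncP; apply; rewrite inE ?VP ?WP orbT.
  apply/allP => W Wst.
  have /stP/exists_inP[B BP /andP[/eqP defW notB]] : W \in push T st.
    by rewrite /push; case: ifP => // _; rewrite inE Wst orbT.
  have xB : x \notin B /\ B \in P.
    have BP' : B \in P.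
      move: BP; rewrite !inE => /predU1P[BE|//]; case/negP: (st_neqT Wst).
      rewrite -defW BE setIUl (setIidPl Tk); apply/eqP/setUidPr.
      by apply/subsetP => i; rewrite !inE => /andP[/eqP->]; rewrite ltnn.
    split=> //; apply/negP => xB; move: support_disjoint.
    have xU : x \in support st :|: ~: past k.+1.
      by rewrite -(cover_partition partP); apply/bigcupP; exists B.
    by move/disjoint_setI0/setP/(_ x); rewrite in_setI xU !inE eqxx.
  case: xB => xB BP'; apply/exists_inP; exists B => //; rewrite pastS setIUr defW.
  have -> : B :&: [set x] = set0.
    apply/setP => i; rewrite !inE; apply/negP => /andP[iB /eqP ix].
    by rewrite -ix iB in xB.
  rewrite set0U eqxx /=; apply: contra notB => /subsetP BS; apply/subsetP => i iB.
  have := BS i iB; rewrite !inE => /orP[/eqP ix|//]; by rewrite -ix iB in xB.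
have lowP B i : B \in P -> i \in B -> (k < i)%N \/ i \in support st.
  move=> BP iB; have : i \in support st :|: ~: past k.+1.
    by rewrite -(cover_partition partP); apply/bigcupP; exists B.
  by rewrite in_setU => /orP[|]; [right|rewrite !inE -leqNgt; left].
have supT i j : i \in support st -> j \in x |: T -> (i < j)%N.
  move=> /supportP[W Wst iW]; rewrite !inE => /predU1P[->|jT].
    by have := subsetP (st_sub Wst) _ iW; rewrite inE.
  by have /beforeP := stT Wst; apply.
have xTk j : j \in x |: T -> (j <= k)%N.
  by rewrite !inE => /predU1P[->//|/(subsetP Tk)]; rewrite inE => /ltnW.
split.
- by [].
- apply/noncrossingP => V W i j k' l; rewrite !in_setU1.
  case/predU1P=> [->|VP]; case/predU1P => [->|WP]; rewrite ?eqxx //; last first.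
    by move=> VW; move/noncrossingP: ncP; apply.
  + move=> _ iV jW k'V lW ij jk kl.
    case: (lowP V k' VP k'V) => [kk'|/supT/(_ jW)].
      by have := xTk _ lW; rewrite leqNgt (ltn_trans kk' kl).
    by rewrite ltnNge (ltnW jk).
  + move=> _ iV jW k'V lW ij jk kl.
    case: (lowP W j WP jW) => [kj|/supT/(_ iV)].
      by have := xTk _ k'V; rewrite leqNgt (ltn_trans kj jk).
    by rewrite ltnNge (ltnW ij).
- apply/allP => W; rewrite /push => Wst.
  have {Wst} : W = T \/ W \in st.
    by move: Wst; case: ifP => _; rewrite ?inE; [right|case/orP => [/eqP|]; auto].
  have sub_past C : C :&: past k = (C :&: past k.+1) :&: past k.
    by rewrite -setIA; congr (_ :&: _); apply/esym/setIidPr; rewrite pastS subsetUr.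
  case=> [->|Wst]; apply/exists_inP.
    exists (x |: T); first by rewrite setU11.
    rewrite setIUl (setIidPl Tk); apply/andP; split.
      by apply/eqP/setUidPr/subsetP => i; rewrite !inE => /andP[/eqP->]; rewrite ltnn.
    by apply/negP => /subsetP/(_ x); rewrite !inE eqxx ltnn => /(_ isT).
  have /exists_inP[C CP /andP[/eqP defW notC]] := stP W Wst.
  exists C; first by rewrite setU1r.
  rewrite sub_past defW; apply/andP; split; first exact/eqP/setIidPl/st_sub.
  by apply: contra notC => CS; apply: subset_trans CS _; rewrite pastS subsetUr.
Qed.

Variables (K : fieldType) (f : {set 'I_n} -> K).
Definition nc_sum (m : nat) (s : seq {set 'I_n}) : K :=
  \sum_(P | open_at m P s) \prod_(V in P) f V.

Lemma nc_sum_trace :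
  \sum_(P | open_at k P (push T st) && (pblock P x :&: past k == T))
     \prod_(V in P) f V =
  nc_sum k.+1 (x |: T :: st) + f (x |: T) * nc_sum k.+1 st.
Proof.
rewrite (bigID (fun P => ~~ (pblock P x \subset past k.+1))) /=; congr (_ + _).
  by apply: eq_bigl => P; rewrite -open_at_keep andbA.
rewrite /nc_sum mulr_sumr.
have pb P : open_at k P (push T st) -> pblock P x :&: past k == T ->
   pblock P x \subset past k.+1 -> pblock P x = x |: T /\ x |: T \in P.
  case/and3P=> partP _ _ /eqP xT xsub; have [xP xx] := x_cover partP.
  suff <- : pblock P x = x |: T by [].
  move: xsub; rewrite pastS => /setIidPl <-; rewrite setIUr xT.
  by rewrite (setIidPr _) // sub1set.
rewrite (reindex_onto (fun P => x |: T |: P) (fun P => P :\ (x |: T))) /=; last first.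
  by move=> P /andP[/andP[oP xT]]; rewrite negbK => /(pb P oP xT)[_ ?]; rewrite setD1K.
have xU P : open_at k.+1 P st -> x |: T \notin P.
  case/and3P => partP _ _; apply/negP => xTP; move: support_disjoint.
  have xU : x \in support st :|: ~: past k.+1.
    by rewrite -(cover_partition partP); apply/bigcupP; exists (x |: T); rewrite ?setU11.
  by move/disjoint_setI0/setP/(_ x); rewrite in_setI xU !inE eqxx.
rewrite (eq_bigl (fun P => open_at k.+1 P st)).
  by apply: eq_bigr => P /xU xP; rewrite big_setU1.
move=> P; have [xP|xP] := boolP (x |: T \in P).
  have -> : ((x |: T) |: P) :\ (x |: T) == P = false.
    by apply/negP => /eqP PE; move: xP; rewrite -PE !inE eqxx.
  by rewrite andbF; apply/esym/negP => /xU; rewrite xP.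
rewrite setU1K // eqxx andbT negbK open_at_close //.
have [oP|//] := boolP (open_at k.+1 P st).
have : open_at k ((x |: T) |: P) (push T st) by rewrite open_at_close.
case/and3P=> partP _ _.
rewrite (def_pblock (partition_trivIset partP) (setU11 _ _) (setU11 _ _)).
rewrite setIUl (setIidPl Tk) pastS setUS // andbT; apply/eqP/setUidPr.
by apply/subsetP => i; rewrite !inE => /andP[/eqP->]; rewrite ltnn.
Qed.

End Step.

Section Sum.
Variables (K : fieldType) (f : {set 'I_n} -> K).

Lemma nc_sum_end st : nested n st -> nc_sum f n st = (nilp st)%:R.
Proof.
have pastn : past n = setT by apply/setP => i; rewrite !inE ltn_ord.
rewrite /nc_sum; case: st => [_|V st _] /=.
  rewrite (big_pred1 set0) ?big_set0 // => P; rewrite /open_at /= andbT pastn setCT setU0.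
  have -> : support [::] = set0 by apply/setP => i; rewrite !inE.
  rewrite partition_set0; have [->|//] := eqVneq P set0.
  by apply/noncrossingP => V W i j k l; rewrite inE.
apply: big1 => P /and3P[_ _ /andP[/exists_inP[B _]]].
by rewrite pastn subsetT andbF.
Qed.

Lemma nc_sum_start : nc_sum f 0 [::] =
  \sum_(P in noncrossing_partitions n) \prod_(V in P) f V.
Proof.
apply: eq_bigl => P; rewrite inE /open_at andbT; congr (partition P _ && _).
by apply/setP => i; rewrite !inE.
Qed.

(** The element [x] opens a block or joins the innermost open block V. It cannot
    join an outer one, because V still has an element l after [x], and the outer
    block, with elements i before V and [x], would cross V at some v in it:
    i < v < x < l. *)
Lemma nc_sum_step k (kn : (k < n)%N) st : nested k st ->
  let x := Ordinal kn in
  nc_sum f k st =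
  nc_sum f k.+1 ([set x] :: st) + f [set x] * nc_sum f k.+1 st +
  (if st is V :: st' then
     nc_sum f k.+1 (x |: V :: st') + f (x |: V) * nc_sum f k.+1 st' else 0).
Proof.
move=> nst x; have x0 : [set x] = x |: set0 by rewrite setU0.
rewrite {1}/nc_sum (bigID (fun P => pblock P x :&: past k == set0)) /=; congr (_ + _).
  have st0 : {in st, forall W, before W set0}.
    by move=> W _; apply/beforeP => i j _; rewrite inE.
  have := nc_sum_trace kn (sub0set _) nst st0 f.
  by rewrite {1}/push eqxx -/x -x0.
case: st nst => [|V st] nst.
  apply: big1 => P /andP[oP /set0Pn[] i]; rewrite inE => /andP[iB ik].
  have [partP _ _] := and3P oP.
  have xP : x \in cover P by rewrite (cover_partition partP) !inE ltnn orbT.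
  have [|] := trace_block oP (pblock_mem xP) iB; last by [].
  by move: ik; rewrite inE.
have [/andP[/andP[V0 Vk] st1] /andP[Vst st2]] := andP nst.
have nst' : nested k st by apply/andP.
have stV : {in st, forall W, before W V} by move=> W Wst; apply: (allP Vst).
rewrite -(nc_sum_trace kn Vk nst' stV f) /push (negPf V0); apply: eq_bigl => P.
have [oP|//] := boolP (open_at k P (V :: st)); rewrite /=.
have [partP ncP stP] := and3P oP.
have xP : x \in cover P by rewrite (cover_partition partP) !inE ltnn orbT.
have [->|] := eqVneq (pblock P x :&: past k) V; first by rewrite V0.
move=> tV; case: eqP => //= /eqP t0; exfalso.
case/set0Pn: (t0) => i; rewrite inE => /andP[iB ik].
have [|tst notB] := trace_block oP (pblock_mem xP) iB; first by move: ik; rewrite inE.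
have {}tst : pblock P x :&: past k \in st.
  by move: tst; rewrite inE (negPf tV).
case/andP: stP => /exists_inP[B BP /andP[/eqP BV notV]] _.
have xB : x \notin B.
  apply/negP => xB; case/eqP: tV.
  by rewrite (def_pblock (partition_trivIset partP) BP xB).
have [v vV] := set0Pn _ V0.
have [l lB lk] := subsetPn notV.
have iv : (i < v)%N.
  by have /beforeP := allP Vst _ tst; apply => //; rewrite inE iB.
have vk : (v < x)%N by have := subsetP Vk v vV; rewrite inE.
have vB : v \in B by move: vV; rewrite -BV inE => /andP[].
have kl : (x < l)%N.
  rewrite inE -leqNgt in lk; rewrite ltn_neqAle lk andbT; apply: contra xB.
  by move=> /eqP xl; rewrite (_ : x = l) //; apply: val_inj.
move/noncrossingP: ncP => /(_ (pblock P x) B i v x l (pblock_mem xP) BP).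
apply => //; last by rewrite mem_pblock.
by apply: contra xB => /eqP <-; rewrite mem_pblock.
Qed.

Lemma nested_push k (kn : (k < n)%N) st (x := Ordinal kn) : nested k st ->
  nested k.+1 ([set x] :: st) /\ nested k.+1 st.
Proof.
case/andP=> /allP st1 st2.
have st1' : all (fun V => (V != set0) && (V \subset past k.+1)) st.
  apply/allP => V /st1 /andP[-> VS] /=; apply: subset_trans VS _.
  by apply/subsetP => i; rewrite !inE ltnS => /ltnW.
split; last exact/andP.
apply/andP; split; apply/andP; split=> //.
  rewrite sub1set inE /= ltnSn andbT; apply/set0Pn; exists x; exact: set11.
apply/allP => W /st1 /andP[_ /subsetP Wk]; apply/beforeP => i j /Wk.
by rewrite !inE => ik /eqP->.
Qed.

Lemma nested_append k (kn : (k < n)%N) V st (x := Ordinal kn) : nested k (V :: st) ->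
  nested k.+1 (x |: V :: st) /\ nested k.+1 st.
Proof.
move=> nV; have [/andP[/andP[V0 Vk] st1] /andP[/allP Vst st2]] := andP nV.
have nst : nested k st by apply/andP.
have [/andP[/andP[x0 st1'] /andP[/allP xst _]] nst'] := nested_push kn nst.
split=> //; apply/andP; split; apply/andP; split=> //.
- apply/andP; split; first by apply/set0Pn; exists x; exact: setU11.
  apply/subsetP => i; rewrite !inE => /predU1P[->//=|/(subsetP Vk)].
  by rewrite inE ltnS => /ltnW.
- apply/allP => W Wst; apply/beforeP => i j iW; rewrite !inE => /predU1P[->|jV].
    by have /beforeP := xst W Wst; apply => //; exact: set11.
  by have /beforeP := Vst W Wst; apply.
Qed.

End Sum.
End NoncrossingScan.

(** * Moments of words from weights of blocks *)

Section Fock.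
Variables (K : fieldType) (L : Type) (kap : seq L -> K).

Definition fock := seq (seq L) -> K.

(** [F st] is the total weight of the ways to finish reading when the stack of
    open blocks is [st], innermost block first. The four terms are: open a block
    with [y], open and close it, join the innermost block, join and close it. *)
Definition read_letter (y : L) (F : fock) : fock := fun st =>
  F ([:: y] :: st) + kap [:: y] * F st +
  (if st is c :: st' then F (rcons c y :: st') + kap (rcons c y) * F st' else 0).

Definition vacuum : fock := fun st => (nilp st)%:R.

Definition read_word (w : seq L) (F : fock) : fock := foldr read_letter F w.

Definition moment (w : seq L) : K := read_word w vacuum [::].

Lemma read_word_cat u v F : read_word (u ++ v) F = read_word u (read_word v F).
Proof. by rewrite /read_word foldr_cat. Qed.

Definition letters (x0 : L) n (w : seq L) (V : {set 'I_n}) : seq L :=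
  [seq nth x0 w (i : 'I_n) | i <- enum V].

Lemma enum_setU1_past n k (kn : (k < n)%N) (V : {set 'I_n}) :
  V \subset past n k -> enum (Ordinal kn |: V) = rcons (enum V) (Ordinal kn).
Proof.
move=> /subsetP Vk; set x := Ordinal kn.
have lt_trans : transitive (fun i j : 'I_n => (i < j)%N).
  by move=> j i l; apply: ltn_trans.
have lt_irr : irreflexive (fun i j : 'I_n => (i < j)%N) by move=> i; exact: ltnn.
have enum_lt (W : {set 'I_n}) : sorted (fun i j : 'I_n => (i < j)%N) (enum W).
  apply: sorted_filter => //; rewrite -enumT -(@sorted_map _ _ val ltn) val_enum_ord.
  exact: iota_ltn_sorted.
apply: (irr_sorted_eq lt_trans lt_irr) => //.
  rewrite sorted_pairwise // pairwise_rcons -sorted_pairwise // enum_lt andbT.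
  by apply/allP => i; rewrite mem_enum => /Vk; rewrite inE.
by move=> i; rewrite mem_rcons inE !mem_enum !inE.
Qed.

(** The reading of positions k, k+1, ... with stack [st] is the sum [nc_sum] with
    the corresponding sets of positions on the stack; both satisfy the same
    recursion in k. *)
Lemma moment_noncrossing (x0 : L) (w : seq L) :
  moment w = \sum_(P in noncrossing_partitions (size w))
               \prod_(V in P) kap (letters x0 w V).
Proof.
rewrite -nc_sum_start; set n := size w.
set f := fun V : {set 'I_n} => kap (letters x0 w V).
suff main m k st : (n - k = m)%N -> (k <= n)%N -> nested k st ->
    read_word (drop k w) vacuum (map (letters x0 w) st) = nc_sum f k st.
  by rewrite -(main n 0 [::]) ?drop0 ?subn0.
elim: m k st => [|m IH] k st km kn nst.
  have -> : k = n by apply/eqP; rewrite eqn_leq kn -subn_eq0 km.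
  rewrite drop_size nc_sum_end; first by case: st {nst}.
  by move: nst; rewrite (_ : k = n) //; apply/eqP; rewrite eqn_leq kn -subn_eq0 km.
have {}kn : (k < n)%N by rewrite -subn_gt0 km.
have km' : (n - k.+1 = m)%N by rewrite subnS km.
have [n1 n2] := nested_push kn nst.
rewrite (drop_nth x0) // (nc_sum_step f kn nst) /= /read_letter.
have l1 : letters x0 w [set Ordinal kn] = [:: nth x0 w k] by rewrite /letters enum_set1.
rewrite -!IH //= l1 /f l1; congr (_ + _).
case: st nst n1 n2 => [|V st] nst n1 n2 //=.
have [n3 n4] := nested_append kn nst.
have lV : letters x0 w (Ordinal kn |: V) = rcons (letters x0 w V) (nth x0 w k).
  rewrite /letters enum_setU1_past ?map_rcons //.
  by case/andP: nst => /andP[/andP[]].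
by rewrite -!IH //= lV.
Qed.

End Fock.

(** * Free cumulants as weights of blocks *)

Section Cumulants.
Variables (K : fieldType) (B : algType K) (L : Type).

(** In the moment-cumulant formula the one-block partition contributes the weight
    of the whole word; by induction on the length all other terms agree. The
    words are over labels because distinct labels may have the same value. *)
Lemma free_cumulant_of_moments (phi : B -> K) (kap : seq L -> K) (y : L -> B) :
  (forall w, phi (\prod_(l <- w) y l) = moment kap w) ->
  forall w, ~~ nilp w -> free_cumulant phi (map y w) = kap w.
Proof.
move=> mom w; have [k] := ubnP (size w); elim: k w => // k IH w wk w0.
have map0 : map y w != [::] by case: w w0 {wk}.
have [x0 _] : exists x0 : L, True by case: w w0 {wk map0} => // x; exists x.
rewrite free_cumulantE // big_map mom (moment_noncrossing kap x0) size_map.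
have letE (V : {set 'I_(size w)}) : subword (map y w) V = map y (letters x0 w V).
  by rewrite /subword /letters -map_comp; apply: eq_map => i /=; rewrite (nth_map x0).
have lT : letters x0 w [set: 'I_(size w)] = w.
  apply: (@eq_from_nth _ x0); rewrite size_map -cardE cardsT card_ord // => j jw.
  rewrite (nth_map (Ordinal jw)) -?cardE ?cardsT ?card_ord //; congr nth.
  by rewrite enum_setT -enumT nth_enum_ord.
have oneNC : [set [set: 'I_(size w)]] \in noncrossing_partitions (size w).
  by case: (w) w0 => // x w' _; apply: one_block_noncrossing.
rewrite (bigD1 _ oneNC) /= big_set1 lT.
rewrite -[RHS]addr0 -addrA; congr (_ + _).
apply/eqP; rewrite subr_eq0; apply/eqP; apply: eq_bigr => P /andP[PNC PT].
have /andP[partP _] : partition P [set: 'I_(size w)] && noncrossing P.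
  by have : P \in noncrossing_partitions (size w) := PNC; rewrite inE.
apply: eq_bigr => V VP.
rewrite letE IH //.
  by rewrite size_map -cardE; apply: leq_trans (partition_block_lt partP PT VP) _.
by rewrite /nilp size_map -cardE -lt0n; apply: partition_block_gt0 partP VP.
Qed.

Lemma moment_free_cumulant (phi : {scalar B}) (s : seq B) : phi 1 = 1 ->
  phi (\prod_(x <- s) x) = moment (free_cumulant phi) s.
Proof.
move=> phi1; have [->|s0] := eqVneq s [::]; first by rewrite big_nil phi1.
rewrite (moment_noncrossing _ 0); case: (free_cumulantsP phi) => _ -> //.
Qed.

End Cumulants.

(** * Freeness from vanishing mixed weights *)

(** A block that has weight zero and keeps it however it is continued can never
    be closed, so a stack containing such a block contributes nothing. *)
Section DeadBlocks.
Variables (K : fieldType) (L : Type) (kap : seq L -> K) (dead : pred (seq L)).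
Hypothesis dead_rcons : forall c y, dead c -> dead (rcons c y).
Hypothesis kap_dead : forall c, dead c -> kap c = 0.

Definition vanishes_at (F : fock K L) := forall st, has dead st -> F st = 0.

Lemma read_letter_vanishes y F : vanishes_at F -> vanishes_at (read_letter kap y F).
Proof.
move=> F0 st st0; rewrite /read_letter (F0 st) // (F0 (_ :: st)) /= ?st0 ?orbT //.
rewrite mulr0 !add0r; case: st st0 => //= c st /orP[c0|st0].
  by rewrite kap_dead ?dead_rcons // mul0r addr0 F0 //= dead_rcons.
by rewrite (F0 st) // mulr0 addr0 F0 //= st0 orbT.
Qed.

Lemma read_word_vanishes w : vanishes_at (read_word kap w (@vacuum K L)).
Proof. by elim: w => [|y w]; [case|exact: read_letter_vanishes]. Qed.

End DeadBlocks.

Section FreenessFromMoments.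
Variables (K : fieldType) (B : algType K) (L : Type) (I : eqType).
Variables (col : L -> I) (kap : seq L -> K).

Definition monochrome (i : I) (c : seq L) := all (fun l => col l == i) c.

Definition pure (c : seq L) := if c is x :: _ then monochrome (col x) c else true.

Hypothesis kap_pure : forall c, ~~ pure c -> kap c = 0.

Local Notation fock := (fock K L).

Local Notation pure_supported := (@vanishes_at K L (predC pure)).

Definition tops_off (i : I) (st : seq (seq L)) :=
  if st is c :: _ then ~~ monochrome i c else true.

Definition run_of (i : I) (u : seq (seq L)) :=
  all (fun c => ~~ nilp c && monochrome i c) u.

(** A function of stacks as a tensor: the run of blocks of color i on top of the
    stack is one factor, the part below it the other. *)
Definition factors (i : I) (F' f F : fock) :=
  forall u st, run_of i u -> tops_off i st -> F' (u ++ st) = f u * F st.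

(** The operators of the algebra of color i act on the first tensor factor only.
    This is how the factors of a free product act on the free product of their
    representation spaces. *)
Definition local (i : I) (Q : fock -> fock) :=
  forall f F F', pure_supported F' -> factors i F' f F ->
    pure_supported (Q F') /\ factors i (Q F') (Q f) F.

Lemma impure_rcons c y : ~~ pure c -> ~~ pure (rcons c y).
Proof.
by case: c => //= x c; rewrite /monochrome /= all_rcons !eqxx /= negb_and orbC => ->.
Qed.

Lemma impure_off i c y : ~~ monochrome i c -> col y = i -> ~~ pure (rcons c y).
Proof.
case: c => //= x c /[swap] yi.
rewrite /monochrome /= all_rcons eqxx yi /= !negb_and eq_sym.
by have [->|] := eqVneq i (col x).
Qed.

(** A letter of color i can only leave the run of blocks of color i by joining a
    block of another color below it, and this creates an impure block. *)
Lemma local_letter y : local (col y) (read_letter kap y).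
Proof.
move=> f F F' sF' fac; split.
  exact: read_letter_vanishes impure_rcons kap_pure _ _ sF'.
move=> u st uy sty; rewrite /read_letter.
have yu : run_of (col y) ([:: y] :: u) by rewrite /= eqxx.
have := fac _ _ yu sty; rewrite /= => ->; rewrite fac // !mulrDl mulrA; congr (_ + _).
case: u uy yu => [_ _|c u /= /andP[/andP[c0 cy] uy] _] /=.
  case: st sty => [|c st] /= sty; first by rewrite mul0r.
  rewrite sF' ?kap_pure ?(impure_off sty) ?mul0r ?addr0 //=.
  by rewrite (impure_off sty).
have cy' : run_of (col y) (rcons c y :: u).
  by rewrite /= /nilp size_rcons /monochrome all_rcons eqxx; apply/andP.
have := fac _ _ cy' sty; rewrite /= => ->.
by rewrite fac // mulrDl mulrA.
Qed.

Lemma local_comp i Q Q' : local i Q -> local i Q' -> local i (fun F => Q (Q' F)).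
Proof. by move=> lQ lQ' f F F' sF' /(lQ' _ _ _ sF')[sF2]; apply: lQ. Qed.

Lemma local_comb i a Q Q' : local i Q -> local i Q' ->
  local i (fun F st => a * Q F st + Q' F st).
Proof.
move=> lQ lQ' f F F' sF' fac.
have [s1 f1] := lQ _ _ _ sF' fac; have [s2 f2] := lQ' _ _ _ sF' fac.
split=> [st st0|u st uy sty]; first by rewrite s1 // s2 // mulr0 addr0.
by rewrite f1 // f2 // mulrDl mulrA.
Qed.

Lemma read_word_comb u a (F1 F2 F : fock) :
  (forall st, F st = a * F1 st + F2 st) ->
  forall st, read_word kap u F st = a * read_word kap u F1 st + read_word kap u F2 st.
Proof.
move=> FE; elim: u => //= y u IH st; rewrite /read_letter !IH.
case: st => [|c st]; last rewrite !IH; ring.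
Qed.

Variables (phi : {scalar B}) (y : L -> B).
Hypothesis phi_moment : forall w, phi (\prod_(l <- w) y l) = moment kap w.

(** F plays the role of the vector obtained by applying b to the vacuum. *)
Definition represents (F : fock) (b : B) :=
  forall u, phi (\prod_(l <- u) y l * b) = read_word kap u F [::].

Definition has_local_operator (i : I) (b : B) :=
  exists2 Q, local i Q & forall F b', represents F b' -> represents (Q F) (b * b').

Lemma represents_comb a F1 F2 b1 b2 : represents F1 b1 -> represents F2 b2 ->
  represents (fun st => a * F1 st + F2 st) (a *: b1 + b2).
Proof.
move=> r1 r2 u; rewrite mulrDr -scalerAr linearP /= r1 r2.
by apply/esym; apply: read_word_comb.
Qed.

Lemma local_operator_comb i a b1 b2 : has_local_operator i b1 ->
  has_local_operator i b2 -> has_local_operator i (a *: b1 + b2).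
Proof.
case=> Q1 l1 r1 [Q2 l2 r2]; exists (fun F st => a * Q1 F st + Q2 F st).
  exact: local_comb.
by move=> F b' Fb; rewrite mulrDl -scalerAl; apply: represents_comb; auto.
Qed.

Lemma local_operator1 i : has_local_operator i 1.
Proof. by exists id => // F b'; rewrite mul1r. Qed.

Lemma local_operators_subalgebra i : unital_subalgebra (has_local_operator i).
Proof.
split=> [|b1 b2 h1 h2|b1 b2 [Q1 l1 r1] [Q2 l2 r2]|a b h].
- exact: local_operator1.
- by rewrite -[b1]scale1r; apply: local_operator_comb.
- exists (fun F => Q1 (Q2 F)); first exact: local_comp.
  by move=> F b' Fb; rewrite -mulrA; auto.
- have zero : has_local_operator i 0.
    by rewrite -(addNr 1) -scaleN1r; apply: local_operator_comb; apply: local_operator1.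
  by rewrite -[_ *: _]addr0; apply: local_operator_comb.
Qed.

(** Let b_1 ... b_m be centered with alternating colors, and let F be the function
    of b_2 ... b_m. It vanishes on stacks whose top is not of the color of b_2,
    so with respect to the color of b_1 it is the vacuum tensored with itself.
    At a stack without such a run on top, applying b_1 multiplies its value by
    the mean of b_1, which is zero; hence the function of b_1 ... b_m vanishes at
    these stacks, in particular at the empty one. *)
Lemma free_of_moments :
  free_sets phi (fun i => [set y l | l in [set l | col l = i]])%classic.
Proof.
move=> m i a m0 aS iS.
have phi1 : phi 1 = 1 by have := phi_moment [::]; rewrite big_nil.
have gen j b : generated_algebra [set y l | l in [set l | col l = j]]%classic b ->
    has_local_operator j b.
  apply; split; first exact: local_operators_subalgebra.
  move=> _ [l <- <-]; exists (read_letter kap l); first exact: local_letter.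
  move=> F b' Fb u; have := Fb (u ++ [:: l]).
  by rewrite read_word_cat big_cat big_seq1 /= mulrA.
(* For the induction the function must be known to vanish off the first color;
   for the empty product it is the vacuum. *)
suff [F Fa [_]] : exists2 F, represents F (\prod_(j < m) (a j - phi (a j) *: 1)) &
    pure_supported F /\ (if m is 0 then F = @vacuum K L
                         else forall st, tops_off (i 0) st -> F st = 0).
  have := Fa [::]; rewrite big_nil mul1r => ->.
  by case: m m0 {aS iS Fa} => // m _; apply.
elim: m i a aS iS {m0} => [|m IH] i a aS iS.
  exists (@vacuum K L); first by move=> u; rewrite big_ord0 mulr1 phi_moment.
  by split=> // -[].
have [||F Fa [sF Ftop]] := IH (fun j => i j.+1) (fun j => a j.+1).
- by move=> j jm; apply: aS.
- by move=> j jm; apply: iS.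
have [Q lQ rQ] : has_local_operator (i 0) (a 0 - phi (a 0) *: 1).
  rewrite addrC -scaleNr; apply: local_operator_comb; first exact: local_operator1.
  by apply: gen; apply: aS.
have Qvac : Q (@vacuum K L) [::] = 0.
  have vac1 : represents (@vacuum K L) 1 by move=> u; rewrite mulr1 phi_moment.
  have := rQ _ _ vac1 [::]; rewrite big_nil mul1r mulr1 linearB linearZ /= phi1.
  by rewrite mulr1 subrr => <-.
have fF : factors (i 0) F (@vacuum K L) F.
  move=> [|c u] st /=; first by rewrite mul1r.
  rewrite mul0r => /andP[/andP[c0 ci] _] _.
  case: m {IH} iS aS {Fa} Ftop => [|m] iS aS; first by move->.
  apply; rewrite /=; case: c c0 ci => // x c _ /= /andP[/eqP xi _].
  by apply/negP => /= /andP[/eqP xi' _]; case: (iS 0 isT); rewrite -xi -xi'.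
have [sQF fQF] := lQ _ _ _ sF fF.
exists (Q F); first by rewrite big_ord_recl; apply: rQ.
by split=> // st /(fQF [::] st isT); rewrite Qvac mul0r.
Qed.

End FreenessFromMoments.

(** * Mixed moments of an element free from a subalgebra *)

Section FreeFromSubalgebra.
Variables (K : fieldType) (B D : algType K) (phi : {scalar B}) (phi1 : phi 1 = 1).
Variables (iota : {lrmorphism D -> B}) (X : B).
Hypothesis X_free : free_from phi [set X]%classic (range iota).

Local Notation t d := (phi (iota d)).
Local Notation kappa := (free_cumulant phi).

(** The first argument is the coefficient accumulated in the current gap; every
    open block carries the coefficient accumulated before it was opened. *)
Definition dfock := D -> seq (seq B * D) -> K.

Definition read_coef (d : D) (F : dfock) : dfock := fun M st => F (M * d) st.

(** Joining a block ends a gap between two of its elements, which contributes its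
    mean; closing a block restores the coefficient of the enclosing gap. *)
Definition read_X (F : dfock) : dfock := fun M st =>
  F 1 (([:: X], M) :: st) + kappa [:: X] * F M st +
  (if st is (c, M') :: st' then
     t M * (F 1 ((rcons c X, M') :: st') + kappa (rcons c X) * F M' st') else 0).

Definition dvacuum : dfock := fun M st => if st is [::] then t M else 0.

Definition read_mixed (u : seq (option D)) (F : dfock) : dfock :=
  foldr (fun o => if o is Some d then read_coef d else read_X) F u.

Definition mixed_product (u : seq (option D)) : B :=
  \prod_(o <- u) (if o is Some d then iota d else X).

Lemma read_mixed_comb u (c : K) (F1 F2 F : dfock) :
  (forall M st, F M st = c * F1 M st + F2 M st) ->
  forall M st,
    read_mixed u F M st = c * read_mixed u F1 M st + read_mixed u F2 M st.
Proof.
move=> FE; elim: u => //= -[d|] u IH M st; first by rewrite /read_coef IH.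
rewrite /read_X !IH; case: st => [|[c' M'] st]; last rewrite !IH; ring.
Qed.

(** Every stored coefficient eventually enters linearly, in a mean or through
    the coefficient restored when its block is closed. *)
Lemma read_mixed0 u M st : (M == 0) || has (fun s => s.2 == 0) st ->
  read_mixed u dvacuum M st = 0.
Proof.
elim: u M st => [|[d|] u IH] M st /=.
- by case: st => //=; rewrite orbF => /eqP->; rewrite !linear0.
- rewrite /read_coef => M0; apply: IH.
  by case/orP: M0 => [/eqP->|->]; rewrite ?mul0r ?eqxx ?orbT.
rewrite /read_X => M0; rewrite IH /= ?M0 ?orbT // IH // mulr0 !add0r.
case: st M0 => [//|[c M'] st] /= /orP[/eqP->|M'0]; first by rewrite !linear0 mul0r.
rewrite IH /= ?M'0 ?orbT // IH //; by rewrite mulr0 addr0 mulr0.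
Qed.

(** [xspan F a z G]: [a] is a polynomial in X, [z] is its action on the vacuum in
    the scan without coefficients, and [G] is its action on [F]. *)
Inductive xspan (F : dfock) : B -> fock K B -> dfock -> Prop :=
| xspan1 : xspan F 1 (@vacuum K B) F
| xspanX a z G : xspan F a z G ->
    xspan F (X * a) (read_letter kappa X z) (read_X G)
| xspanD c a z G a' z' G' : xspan F a z G -> xspan F a' z' G' ->
    xspan F (c *: a + a') (fun s => c * z s + z' s)
          (fun M st => c * G M st + G' M st).

Lemma xspan_mean F a z G : xspan F a z G -> phi a = z [::].
Proof.
move=> xG; suff /(_ 0%N) : forall j, phi (X ^+ j * a) = read_word kappa (nseq j X) z [::].
  by rewrite mul1r.
elim: {a z G} xG => [j|a z G _ IH j|c a z G a' z' G' _ IH _ IH' j].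
- rewrite mulr1 -[RHS]/(moment kappa _) -moment_free_cumulant //.
  by rewrite big_nseq -Monoid.iteropE.
- have -> : X ^+ j * (X * a) = X ^+ j.+1 * a by rewrite exprSr mulrA.
  rewrite IH -[read_letter _ _ _]/(read_word kappa [:: X] z) -read_word_cat.
  by rewrite -[[:: X]]/(nseq 1 X) -nseqD addn1.
- rewrite mulrDr -scalerAr linearP /= IH IH'.
  by apply/esym; apply: read_word_comb.
Qed.

Lemma xspan_generated F a z G : xspan F a z G ->
  generated_algebra [set X]%classic a.
Proof.
move=> xG S [Ssub SX]; case: (Ssub) => S1 SD SM SZ.
elim: xG => // [b z' G' _ Sb|c b z' G' b' z'' G'' _ Sb _ Sb'].
  by apply: SM => //; apply: SX.
by apply: SD => //; apply: SZ.
Qed.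

(** The configuration reached from coefficient M and stack [st] after reading
    powers of X that left open the blocks u: the outermost of these blocks
    stores M, and the others were opened right after a power of X. *)
Definition inner M (u : seq (seq B)) : D := if u is [::] then M else 1.

Fixpoint stacked M (u : seq (seq B)) st : seq (seq B * D) :=
  if u is c :: u' then (c, inner M u') :: stacked M u' st else st.

(** As long as a power of X does not touch the given stack [st], it is read as if
    there were no coefficients, and it must have closed its own blocks because F
    vanishes when the current coefficient is 1 and a block is open. The first
    time it joins a block of [st], the mean of M is paid and M disappears; this
    is the term with R, which is absent if there is no such block. *)
Lemma xspan_split F a z G : (forall s st, F 1 (s :: st) = 0) ->
  xspan F a z G ->
  exists2 R : seq (seq B) -> seq (seq B * D) -> K, (forall u, R u [::] = 0) &
    forall M u st, G (inner M u) (stacked M u st) = z u * F M st + t M * R u st.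
Proof.
move=> F0; elim=> [|b z' G' _ [R R0 RE]|c b z' G' b' z'' G'' _ [R R0 RE] _ [R' R'0 R'E]].
- exists (fun _ _ => 0) => // M [|c u] st; first by rewrite mul1r mulr0 addr0.
  by rewrite /= F0 mul0r mulr0 addr0.
- exists (fun u st => R ([:: X] :: u) st + kappa [:: X] * R u st +
     match u, st with
     | c :: u', _ => R (rcons c X :: u') st + kappa (rcons c X) * R u' st
     | [::], (c, M') :: st' =>
         G' 1 ((rcons c X, M') :: st') + kappa (rcons c X) * G' M' st'
     | _, _ => 0
     end) => [[|c u]|M u st]; rewrite ?R0; try ring.
  rewrite /read_X /read_letter.
  have /= -> := RE M ([:: X] :: u) st; rewrite (RE M u st).
  case: u => [|c u] /=; first by case: st => [|[c M'] st]; ring.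
  have /= -> := RE M (rcons c X :: u) st; rewrite (RE M u st).
  by rewrite rmorph1 phi1; ring.
- exists (fun u st => c * R u st + R' u st) => [u|M u st].
    by rewrite R0 R'0 mulr0 addr0.
  by rewrite RE R'E; ring.
Qed.

(** Alternating products of centered polynomials in X and centered coefficients,
    together with their action on the vacuum; the boolean tells whether the
    first factor is a polynomial in X. *)
Inductive tail : bool -> seq B -> dfock -> Prop :=
| tail0 b : tail b [::] dvacuum
| tailX a z e F G : tail false e F -> xspan F a z G -> phi a = 0 ->
    tail true (a :: e) G
| tailD d e F : tail true e F -> t d = 0 ->
    tail false (iota d :: e) (read_coef d F).

(** The two types of tails feed each other: after a centered polynomial in X the
    function sees only the mean of the current coefficient, so a centered
    coefficient makes it vanish when the current coefficient is 1, which is what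
    [xspan_split] asks for the next polynomial. *)
Lemma tailP b e F : tail b e F ->
  [/\ b -> forall M st, F M st = t M * F 1 st,
      ~~ b -> forall s st, F 1 (s :: st) = 0
    & e != [::] -> F 1 [::] = 0].
Proof.
elim=> {b e F} [b|a z e F G _ [_ F0 _] xG a0|d e F _ [Ft _ _] d0].
- by split=> // _ M [|s st] /=; rewrite ?rmorph1 ?phi1 ?mulr1 ?mulr0.
- have [R R0 RE] := xspan_split (F0 isT) xG.
  have GE M st : G M st = t M * R [::] st.
    by have := RE M [::] st; rewrite -(xspan_mean xG) a0 mul0r add0r.
  by split=> // _ => [M st|]; rewrite !GE ?R0 ?mulr0 // rmorph1 phi1 mul1r.
- by split=> // _ => [s st|]; rewrite /read_coef mul1r (Ft isT) d0 mul0r.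
Qed.

Lemma tail_alternates b e F : tail b e F -> forall j, (j < size e)%N ->
  generated_algebra (if b (+) odd j then [set X]%classic else range iota) e`_j /\
  phi e`_j = 0.
Proof.
elim=> {b e F} [//|a z e F G _ IH xG a0|d e F _ IH d0] [|j] /=.
- by move=> _; split=> //; apply: xspan_generated xG.
- by move/IH => /=; rewrite negbK.
- move=> _; split=> // S [_]; apply; by exists d.
- by move/IH.
Qed.

(** Both sides vanish on nonempty products: the left one by the freeness of X
    from the coefficients, the right one by the scan. *)
Lemma tail_mean b e F : tail b e F -> phi (\prod_(x <- e) x) = F 1 [::].
Proof.
move=> tF; have [_ _ F0] := tailP tF.
have [e0|e0] := eqVneq e [::].
  by move: tF; rewrite e0 big_nil phi1 => tF; inversion tF; rewrite /= rmorph1.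
rewrite F0 //; have alt := tail_alternates tF.
have := @X_free (size e) (fun j => b (+) odd j) (fun j => e`_j).
rewrite (big_nth 0) big_mkord => fr; rewrite -[RHS]fr.
- congr (phi _); apply: eq_bigr => j _; have [_ ->] := alt j (ltn_ord j).
  by rewrite scale0r subr0.
- by case: (e) e0.
- by move=> j /alt[].
- by move=> j _ /=; case: (b) => /=; case: (odd j).
Qed.

Lemma tail_factorX b e F : tail b e F -> exists e' F' a z,
  [/\ tail false e' F', xspan F' a z F & \prod_(x <- e) x = a * \prod_(x <- e') x].
Proof.
case=> {b e F} [b|a z e F G tF xG a0|d e F tF d0].
- exists [::], dvacuum, 1, (@vacuum K B).
  by split; [apply: tail0|apply: xspan1|rewrite mul1r].
- by exists e, F, a, z; split=> //; rewrite big_cons.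
- exists (iota d :: e), (read_coef d F), 1, (@vacuum K B).
  by split; [apply: tailD|apply: xspan1|rewrite mul1r].
Qed.

Lemma tail_factorD b e F : tail b e F -> exists e' F' d,
  [/\ tail true e' F', (forall M st, F M st = F' (M * d) st)
    & \prod_(x <- e) x = iota d * \prod_(x <- e') x].
Proof.
case=> {b e F} [b|a z e F G tF xG a0|d e F tF d0].
- exists [::], dvacuum, 1; split; [exact: tail0|by move=> M st; rewrite mulr1|].
  by rewrite rmorph1 mul1r.
- exists (a :: e), G, 1; split; [exact: tailX xG a0|by move=> M st; rewrite mulr1|].
  by rewrite rmorph1 mul1r.
- by exists e, F, d; split=> //; rewrite big_cons.
Qed.

(** Induction on u, absorbing its last letter into the tail: it is multiplied
    with the first factor of the tail if that has the same kind, and the result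
    is split into a centered element and a scalar. Either part leaves a tail
    after the shorter word. *)
Lemma mixed_tail u b e F : tail b e F ->
  phi (mixed_product u * \prod_(x <- e) x) = read_mixed u F 1 [::].
Proof.
elim/last_ind: u b e F => [|u o IH] b e F tF.
  by rewrite /mixed_product big_nil mul1r (tail_mean tF).
rewrite /mixed_product -cats1 big_cat big_seq1 -/(mixed_product u) -mulrA.
rewrite /read_mixed foldr_cat /= -/(read_mixed _ _).
case: o => [d|].
  have [e' [F' [d' [tF' FE ->]]]] := tail_factorD tF.
  have [/(_ isT) Ft _ _] := tailP tF'.
  (* d d' is split into its centered part d2 and its mean c. *)
  set c := t (d * d'); pose d2 := - c *: 1 + d * d'.
  have d20 : t d2 = 0.
    by rewrite linearP /= linearP /= rmorph1 phi1 mulr1 addNr.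
  have := IH _ _ _ (tailD tF' d20); rewrite big_cons.
  rewrite (@read_mixed_comb u (- c) F' (read_coef d F)); last first.
    move=> M st; rewrite /read_coef FE Ft [F' M st]Ft [F' (_ * _) _]Ft.
    rewrite mulrDr -scalerAr mulr1 linearP /= linearP /= mulrA; ring.
  rewrite -(IH _ _ _ tF') linearP /= rmorph1 rmorphM mulrDl mulrDr.
  rewrite -scalerAl mul1r -scalerAr linearP /= -mulrA.
  by move/addrI.
have [e' [F' [a [z [tF' xF ->]]]]] := tail_factorX tF.
(* X a is split into its centered part a2 and its mean c. *)
set c := phi (X * a).
have := xspanD (- c) (xspan1 F') (xspanX xF).
set a2 := _ + X * a => x2.
have a20 : phi a2 = 0 by rewrite linearP /= phi1 mulr1 addNr.
have := IH _ _ _ (tailX tF' x2 a20); rewrite big_cons.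
rewrite (@read_mixed_comb u (- c) F' (read_X F)) //.
rewrite -(IH _ _ _ tF') mulrDl mulrDr -scalerAl mul1r -scalerAr linearP /= -mulrA.
by move/addrI.
Qed.

Lemma mixed_moment u : phi (mixed_product u) = read_mixed u dvacuum 1 [::].
Proof. by have := mixed_tail u (tail0 true); rewrite big_nil mulr1. Qed.

End FreeFromSubalgebra.

(** * Scalar matrices and matrix units *)

Section Embedding.
Variables (K : fieldType) (A : algType K) (n : nat).

Definition embed (M : 'M[K]_n.+1) : matrix_algebra A n := map_mx (in_alg A) M.

Fact embed_is_linear : linear embed.
Proof.
by move=> c M M'; apply/matrixP => i j; rewrite !mxE /= scalerDl scalerA.
Qed.

Fact embed_is_monoid_morphism : monoid_morphism embed.
Proof. by split=> [|M M']; [exact: map_mx1|exact: map_mxM]. Qed.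

HB.instance Definition _ :=
  GRing.isLinear.Build K 'M[K]_n.+1 (matrix_algebra A n) _ embed embed_is_linear.
HB.instance Definition _ :=
  GRing.isMonoidMorphism.Build 'M[K]_n.+1 (matrix_algebra A n) embed
    embed_is_monoid_morphism.

Definition corner (a : A) : matrix_algebra A n :=
  \matrix_(i, j) (if (i == ord0) && (j == ord0) then a else 0).

Lemma corner_mul a b : corner a * corner b = corner (a * b).
Proof.
apply/matrixP => i j; rewrite !mxE (bigD1 ord0) //= !mxE eqxx andbT.
rewrite big1 => [|k k0]; last by rewrite !mxE (negPf k0) andbF mul0r.
by rewrite addr0; case: ifP => _; case: ifP => _; rewrite ?mul0r ?mulr0.
Qed.

Lemma embed_corner : embed (delta_mx ord0 ord0) = corner 1.
Proof.
by apply/matrixP => i j; rewrite !mxE; case: (_ && _); rewrite /= ?scale1r ?scale0r.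
Qed.

Lemma compress_entry (X : matrix_algebra A n) i j :
  embed (delta_mx ord0 i) * X * embed (delta_mx j ord0) = corner (X i j).
Proof.
apply/matrixP => k l; rewrite !mxE (bigD1 j) //= big1 => [|m mj]; last first.
  by rewrite !mxE (negPf mj) /= scale0r mulr0.
rewrite !mxE (bigD1 i) //= big1 => [|m mi]; last first.
  by rewrite !mxE (negPf mi) andbF /= scale0r mul0r.
rewrite !mxE !eqxx andbT !addr0 /=.
by case: (k == _); case: (l == _);
  rewrite /= ?scale1r ?scale0r ?mul1r ?mulr1 ?mul0r ?mulr0.
Qed.

End Embedding.

Section EmbeddedTrace.
Variables (K : numFieldType) (A : algType K) (n : nat).
Variables (tau : {scalar A}) (tau1 : tau 1 = 1).

Lemma trace_embed (M : 'M[K]_n.+1) :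
  normalized_trace tau (embed A M) = n.+1%:R^-1 * \tr M.
Proof.
congr (_ * _); apply: eq_bigr => i _.
by rewrite !mxE linearZ /= tau1 mulr1.
Qed.

Lemma trace_corner a : normalized_trace tau (corner n a) = n.+1%:R^-1 * tau a.
Proof.
congr (_ * _); rewrite (bigD1 ord0) //= mxE eqxx big1 ?addr0 // => i i0.
by rewrite mxE (negPf i0) linear0.
Qed.

Lemma normalized_trace1 : normalized_trace tau (1 : matrix_algebra A n) = 1.
Proof.
have <- : embed A (1%:M) = 1 :> matrix_algebra A n.
  by rewrite -[RHS](rmorph1 (embed A (n := n))).
by rewrite trace_embed mxtrace1 mulVf // pnatr_eq0.
Qed.

Lemma trace_delta i j :
  normalized_trace tau (embed A (delta_mx i j : 'M[K]_n.+1)) = n.+1%:R^-1 * (i == j)%:R.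
Proof.
rewrite trace_embed; congr (_ * _); rewrite /mxtrace (bigD1 i) //= mxE eqxx.
rewrite big1 ?addr0 //.
by move=> k ki; rewrite mxE (negPf ki).
Qed.

End EmbeddedTrace.

(** * Alternating words in a group *)

Section GroupWords.
Variable gT : finGroupType.
Implicit Types (c w : seq gT) (g x : gT).

(** Reading [c] along a path moves the vertex p to [charge c * p]. *)
Definition charge c : gT := (\prod_(g <- rev c) g)%g.

Lemma charge_rcons c g : charge (rcons c g) = (g * charge c)%g.
Proof. by rewrite /charge rev_rcons big_cons. Qed.

Lemma charge_cons c g : charge (g :: c) = (charge c * g)%g.
Proof. by rewrite /charge rev_cons -cats1 big_cat big_seq1. Qed.

Definition alternating c := sorted (fun g h => h == g^-1)%g c.

Definition balanced c := alternating c && (charge c == 1%g).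

Lemma alternating_cons x c : alternating (x :: c) ->
  charge (x :: c) = (if odd (size c) then 1 else x)%g /\
  last x c = (if odd (size c) then x^-1 else x)%g.
Proof.
elim/last_ind: c => [|c g IH]; first by rewrite /charge /= big_seq1.
rewrite /alternating /= rcons_path => /andP[/IH[ch la] /eqP ->].
rewrite -rcons_cons charge_rcons ch last_rcons la size_rcons /=.
by case: odd; rewrite /= ?invgK ?mulg1 ?mulVg.
Qed.

(** The left side is the closing condition seen on the matrix units, the right
    side says that [charge] becomes 1 after appending the inverse of the last
    letter. *)
Lemma alternating_close x c : alternating (x :: c) ->
  (charge (x :: c) == x) = (charge (x :: c) == last x c).
Proof.
move=> /alternating_cons[-> ->]; case: odd; rewrite ?eqxx //.
by rewrite ![(1 == _)%g]eq_sym invg_eq1.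
Qed.

Lemma not_alternating_rcons c g : ~~ alternating c -> ~~ alternating (rcons c g).
Proof.
case: c => // x c; apply: contra.
by rewrite /alternating /= rcons_path => /andP[].
Qed.

End GroupWords.

(** * Moments of the circulant parts *)

Section CirculantWords.
Variables (K : numFieldType) (A : algType K) (tau : {scalar A}) (tau1 : tau 1 = 1).
Variables (gT : finGroupType) (n : nat) (enumG : 'I_n.+1 -> gT).
Variables (ix : gT -> 'I_n.+1) (enumK : cancel enumG ix) (ixK : cancel ix enumG).
Variable X : matrix_algebra A n.

Local Notation MA := (matrix_algebra A n).
Local Notation phi := (normalized_trace tau).
Local Notation emb := (embed A (n := n)).
Local Notation delta i j := (delta_mx i j : 'M[K]_n.+1).

Definition circ (g : gT) : MA := left_circulant enumG X^T g.

(** Each joining of a block pays the trace of a matrix unit, 1 / N, whence the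
    exponent. *)
Definition circ_cumulant (c : seq gT) : K :=
  n.+1%:R^-1 ^+ (size c).-1 * free_cumulant phi (nseq (size c) X) *
  (balanced c)%:R.

Fixpoint path_product (p : gT) (w : seq gT) : A :=
  if w is g :: w' then X (ix (g * p)%g) (ix p) * path_product (g * p)%g w' else 1.

(** The letter g read at the vertex p selects the entry of X in row g p and
    column p and carries it to the corner of index 0. *)
Fixpoint path_word (p : gT) (w : seq gT) : seq (option 'M[K]_n.+1) :=
  if w is g :: w' then
    [:: Some (delta_mx ord0 (ix (g * p)%g)); None; Some (delta_mx (ix p) ord0)]
      ++ path_word (g * p)%g w'
  else [::].

Lemma circ_prodE w i j : (\prod_(g <- w) circ g) i j =
  if enumG j == (charge w * enumG i)%g then path_product (enumG i) w else 0.
Proof.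
elim: w i => [|g w IH] i.
  by rewrite big_nil !mxE /charge big_nil mul1g (can_eq enumK) eq_sym; case: eqP.
rewrite big_cons mxE (bigD1 (ix (g * enumG i)%g)) //= [X in _ + X]big1 => [|k ki].
  rewrite addr0 IH !mxE ixK eqxx charge_cons enumK -mulgA.
  by case: ifP => _; rewrite ?mulr0.
rewrite mxE; case: eqP => [kE|_]; last by rewrite mul0r.
by case/eqP: ki; rewrite -kE enumK.
Qed.

Lemma corner_path a p w :
  corner n a * mixed_product emb X (path_word p w) = corner n (a * path_product p w).
Proof.
rewrite /mixed_product; elim: w a p => [|g w IH] a p /=.
  by rewrite big_nil !mulr1.
rewrite !big_cons [X in _ * X]mulrA [X in _ * X]mulrA compress_entry mulrA.
by rewrite corner_mul IH mulrA.
Qed.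

(** The state of the scan with coefficients when the reading of letters has
    reached the vertex p with stack [st]; the current coefficient is the matrix
    unit with the returned row and column 0. If c is the top block, it was
    opened at the vertex p' = (charge c)^-1 p, since the blocks closed meanwhile
    have charge 1. The column of the matrix unit it stores is the row of its
    first entry, (head c) p'; the current gap starts with the column of its last
    entry, (last c)^-1 p. *)
Fixpoint stack_state (p : gT) (st : seq (seq gT)) :
    'I_n.+1 * seq (seq MA * 'M[K]_n.+1) :=
  if st is c :: st' then
    let below := stack_state ((charge c)^-1 * p)%g st' in
    (ix ((last 1 c)^-1 * p)%g,
     (nseq (size c) X,
      delta_mx below.1 (ix (head 1 c * ((charge c)^-1 * p))%g)) :: below.2)
  else (ord0, [::]).

(** What the open blocks have already paid in the scan with coefficients; in the
    scan of letters a block pays only when it is closed. *)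
Definition weight (st : seq (seq gT)) : K := \prod_(c <- st) n.+1%:R^-1 ^+ (size c).-1.

Local Notation vac := (@vacuum K gT).
Local Notation read w := (read_word circ_cumulant w vac).
Local Notation mread w := (read_mixed phi emb X w (dvacuum phi emb)).

Lemma circ_cumulant_dead c : ~~ alternating c -> circ_cumulant c = 0.
Proof. by rewrite /circ_cumulant /balanced => /negPf->; rewrite mulr0. Qed.

Lemma delta_mul (a b c d : 'I_n.+1) :
  (delta a b : 'M[K]_n.+1) * delta c d = if b == c then delta a d else 0.
Proof.
case: eqP => [->|/eqP bc]; first exact: mul_delta_mx.
exact: mul_delta_mx_0.
Qed.

Lemma mread0 w st : mread w 0 st = 0.
Proof. by apply: read_mixed0; rewrite eqxx. Qed.

(** A letter g joins the top block c in the scan with coefficients if the gap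
    coefficient has nonzero trace, that is (last c)^-1 p = g p: the word stays
    alternating. Closing the block multiplies its stored matrix unit with one in
    row p, which is nonzero if (head c) p' = p; by [alternating_close] this says
    that the closed block has charge 1, and then g p = p' is the vertex of the
    stack below. *)
Lemma path_simulation w p st :
  all (fun c => ~~ nilp c && alternating c) st ->
  weight st * mread (path_word p w) (delta (stack_state p st).1 ord0)
                (stack_state p st).2 =
  n.+1%:R^-1 * read w st.
Proof.
elim: w p st => [|g w IH] p st live.
  case: st live => [|c st] _ /=; last by rewrite !mulr0.
  by rewrite /weight big_nil mul1r trace_delta // eqxx.
set M := (stack_state p st).1; set mst := (stack_state p st).2.
rewrite /= {1}/read_letter.
have open_term : weight st * mread (path_word (g * p)%g w) (delta (ix p) ord0)
      (([:: X], delta M (ix (g * p)%g)) :: mst) = n.+1%:R^-1 * read w ([:: g] :: st).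
  have := IH (g * p)%g ([:: g] :: st).
  rewrite /= live /charge big_seq1 mulKg => /(_ isT) <-.
  by rewrite /weight big_cons expr0 mul1r.
have stay_term : weight st * (free_cumulant phi [:: X] *
      mread (path_word (g * p)%g w) (delta M (ix (g * p)%g) * delta (ix p) ord0) mst) =
    n.+1%:R^-1 * (circ_cumulant [:: g] * read w st).
  rewrite delta_mul (can_eq ixK) (eq_mulgV1 (g * p)%g) mulgK.
  have -> : circ_cumulant [:: g] = free_cumulant phi [:: X] * (g == 1%g)%:R.
    by rewrite /circ_cumulant expr0 mul1r /balanced /charge big_seq1.
  case: eqP => [->|_]; last by rewrite mulr0 mul0r !mulr0 mread0 !mulr0.
  by rewrite mul1g mulr1 mulrCA IH // mulrCA.
rewrite /read_coef -/(read_mixed phi emb X _ _) /read_X delta_mul eqxx mul1r.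
rewrite !mulrDr open_term stay_term -!addrA; congr (_ + (_ + _)).
rewrite {open_term stay_term}/M {M}/mst {mst}.
case: st live => [|c st] live /=; first by rewrite !mulr0.
have /andP[/andP[c0 altc] live'] := live.
rewrite trace_delta // (can_eq ixK) (inj_eq (mulIg p)).
have alt_rcons : alternating (rcons c g) = ((last 1%g c)^-1%g == g).
  case: c c0 altc {live} => // x c _; rewrite /alternating /= rcons_path => ->.
  by rewrite eq_sym.
have [gl|gl] := eqVneq (last 1%g c)^-1%g g; last first.
  have dead : ~~ alternating (rcons c g) by rewrite alt_rcons.
  rewrite mulr0 mul0r mulr0 circ_cumulant_dead // mul0r addr0.
  rewrite (read_word_vanishes (dead := predC (@alternating gT))) ?mulr0 //=.
  - exact: not_alternating_rcons.
  - exact: circ_cumulant_dead.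
  - by rewrite dead.
have alt' : alternating (rcons c g) by rewrite alt_rcons gl eqxx.
have sz : size c = (size c).-1.+1 by case: (c) c0.
have wE : weight (rcons c g :: st) = n.+1%:R^-1 * weight (c :: st).
  by rewrite /weight !big_cons size_rcons /= {1}sz exprS mulrA.
have headr : head 1%g (rcons c g) = head 1%g c by case: (c) c0.
have nX : rcons (nseq (size c) X) X = nseq (size c).+1 X.
  by rewrite -cats1 -[[:: X]]/(nseq 1 X) -nseqD addn1.
rewrite mulr1 mulrCA mulrDr mulrDr [RHS]mulrDr; congr (_ + _).
  have live_rcons : all (fun c => ~~ nilp c && alternating c) (rcons c g :: st).
    by apply/andP; split; rewrite // alt' andbT /nilp size_rcons.
  have := IH (g * p)%g _ live_rcons; rewrite /= => <-.
  rewrite wE charge_rcons last_rcons mulKg invMg -mulgA mulKg nX mulrA.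
  by rewrite size_rcons headr.
rewrite delta_mul (can_eq ixK).
(* The condition under which the product of matrix units survives. *)
have headE : (head 1%g c * ((charge c)^-1 * p) == p)%g = (charge (rcons c g) == 1%g).
  rewrite charge_rcons mulgA -[X in _ == X]mul1g (inj_eq (mulIg p)) -eq_mulgV1 -gl.
  rewrite -eq_mulVg1 eq_sym [RHS]eq_sym.
  case: c c0 altc {live alt_rcons gl alt' sz wE nX headr} => // x c _.
  exact: alternating_close.
rewrite headE /circ_cumulant /balanced alt' size_rcons /= nX.
case: eqP => [ch1|_]; last by rewrite mread0 !mulr0 mul0r mulr0.
rewrite mulr1.
have gp : ((charge c)^-1 * p = g * p)%g.
  by congr (_ * p)%g; rewrite -[LHS]mul1g -ch1 charge_rcons mulgK.
rewrite gp mulrCA.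
have -> : weight (c :: st) = n.+1%:R^-1 ^+ (size c).-1 * weight st.
  by rewrite /weight big_cons.
have -> : n.+1%:R^-1 ^+ size c = n.+1%:R^-1 * n.+1%:R^-1 ^+ (size c).-1 :> K.
  by rewrite {1}sz exprS.
have := IH (g * p)%g st live'; move: (read _ _) (mread _ _ _) => r m rm.
transitivity (n.+1%:R^-1 ^+ (size c).-1 * free_cumulant phi (nseq (size c).+1 X) *
              n.+1%:R^-1 * (weight st * m)); first by ring.
by rewrite rm; ring.
Qed.

(** Only blocks of charge 1 are closed, so the total charge of what is open and
    of what remains to be read is invariant, and it is 1 at the end. *)
Lemma charge_moment w st :
  (charge w * \prod_(c <- st) charge c)%g != 1%g -> read w st = 0.
Proof.
elim: w st => [|g w IH] st /=.
  by case: st => [|c st] //; rewrite /charge !big_nil mulg1 eqxx.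
have kap0 c : charge c != 1%g -> circ_cumulant c = 0.
  by rewrite /circ_cumulant /balanced => /negPf->; rewrite andbF mulr0.
rewrite charge_cons /read_letter => ne1.
rewrite IH; last by rewrite big_cons /charge big_seq1 mulgA.
have -> : circ_cumulant [:: g] * read w st = 0.
  have [g1|g1] := eqVneq g 1%g; last by rewrite kap0 ?mul0r // /charge big_seq1.
  by rewrite IH ?mulr0 //; rewrite g1 mulg1 in ne1.
rewrite !add0r; case: st ne1 => // c st; rewrite big_cons => ne1.
rewrite IH ?add0r; last by move: ne1; rewrite big_cons charge_rcons !mulgA.
have [c1|/kap0->] := eqVneq (charge (rcons c g)) 1%g; last by rewrite mul0r.
rewrite IH ?mulr0 //; move: ne1.
by rewrite mulgA -(mulgA _ g) -charge_rcons c1 mulg1.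
Qed.

Hypothesis X_free : free_from phi [set X]%classic (base_field_matrices A n).

(** The diagonal entries of the product are the path products of closed paths.
    They all have the same expectation, and if the path does not close, that
    is if [charge w] is not 1, both sides are zero. *)
Lemma circ_moment w : phi (\prod_(g <- w) circ g) = moment circ_cumulant w.
Proof.
have phi1 : phi 1 = 1 := normalized_trace1 n tau1.
have N0 : n.+1%:R != 0 :> K by rewrite pnatr_eq0.
have entry p : tau (path_product p w) = moment circ_cumulant w.
  have sim := @path_simulation w p [::] isT.
  apply: (mulfI (invr_neq0 N0)); rewrite -[RHS]sim /weight big_nil mul1r.
  have := @mixed_moment K MA _ phi phi1 emb X X_free
            (Some (delta ord0 ord0) :: path_word p w).
  rewrite /= /read_coef mul1r => <-.
  rewrite /mixed_product big_cons /= -/(mixed_product _ _ _) embed_corner corner_path.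
  by rewrite mul1r trace_corner.
have [w1|w1] := eqVneq (charge w) 1%g; last first.
  rewrite /moment charge_moment ?big_nil ?mulg1 //.
  rewrite /normalized_trace big1 ?mulr0 // => i _; rewrite circ_prodE.
  rewrite -[X in X == _]mul1g (inj_eq (mulIg _)) eq_sym (negPf w1).
  exact: linear0.
rewrite /normalized_trace (eq_bigr (fun=> moment circ_cumulant w)) => [|i _].
  by rewrite sumr_const card_ord -[X in _ * X]mulr_natl mulKf.
by rewrite circ_prodE w1 mul1g eqxx.
Qed.

End CirculantWords.

(** * The sets of inverse elements as colors *)

Section Colors.
Variable gT : finGroupType.

Definition pair_of (g : gT) : {P : {set gT} | P \in inverse_pairs gT} :=
  exist _ [set g; g^-1]%g (imset_f (fun g : gT => [set g; g^-1]%g) (isT : g \in gT)).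

Lemma pair_ofP (P : {P : {set gT} | P \in inverse_pairs gT}) g :
  (g \in val P) = (pair_of g == P).
Proof.
rewrite -val_eqE /=; case: P => /= P /imsetP[h _ ->].
apply/idP/eqP => [|<-]; last by rewrite !inE eqxx.
by rewrite !inE => /orP[/eqP->//|/eqP->]; rewrite invgK setUC.
Qed.

Lemma alternating_pure (c : seq gT) : alternating c -> pure pair_of c.
Proof.
case: c => // x c; rewrite /pure /monochrome /= eqxx /= /alternating /=.
suff main p : pair_of p = pair_of x -> path (fun g h => h == g^-1)%g p c ->
    all (fun l => pair_of l == pair_of x) c by apply: main.
elim: c p => //= g c IH p px /andP[/eqP-> pc].
have gx : pair_of p^-1%g = pair_of x.
  by apply/eqP; rewrite -pair_ofP -px /= !inE eqxx orbT.
by rewrite gx eqxx (IH _ gx pc).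
Qed.

End Colors.

(** * Freeness and R-diagonality *)

Theorem theorem4p5 (R : realType) (A : algType R[i]) (star : A -> A)
    (star_axioms : star_operation star)
    (tau : {scalar A}) (tau1 : tau 1 = 1)
    (gT : finGroupType) (n : nat) (enumG : 'I_n.+1 -> gT)
    (enumG_bij : bijective enumG) (enumG0 : enumG ord0 = 1%g)
    (X : matrix_algebra A n)
    (X_free : free_from (normalized_trace tau) [set X]%classic
                (base_field_matrices A n)) :
  let Y : gT -> matrix_algebra A n := left_circulant enumG X^T in
  free_sets (normalized_trace tau)
    (fun P : {P : {set gT} | P \in inverse_pairs gT} =>
       [set Y g | g in [set` val P]]%classic) /\
  forall g : gT, g != 1%g ->
    (g != g^-1%g ->
       R_diagonal_pair (normalized_trace tau) (Y g) (Y g^-1%g)) /\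
    (g = g^-1%g ->
       odd_cumulants_vanish (normalized_trace tau) (Y g)).
Proof.
move=> Y; case: (enumG_bij) => ix enumK ixK.
have moments := circ_moment tau1 enumK ixK X_free.
set kap := circ_cumulant tau X in moments.
have cumulants := free_cumulant_of_moments moments.
have kap0 c : ~~ balanced c -> kap c = 0.
  by rewrite /kap /circ_cumulant => /negPf->; rewrite mulr0.
split=> [|g g1].
  have kap_pure c : ~~ pure (@pair_of gT) c -> kap c = 0.
    move=> /(contra (@alternating_pure gT c)) ac.
    by rewrite kap0 // /balanced negb_and ac.
  have -> : (fun P : {P : {set gT} | P \in inverse_pairs gT} =>
               [set Y g | g in [set` val P]]%classic) =
            (fun P => [set Y g | g in [set g | pair_of g = P]]%classic).
    apply/funext => P.
    suff -> : [set` val P]%classic = [set g | pair_of g = P]%classic by [].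
    by apply/funext => g; apply/propext; rewrite /= pair_ofP; split=> /eqP.
  have := free_of_moments kap_pure moments.
  exact.
split=> [gV w w0|gV m mo].
  pose lab (l : bool) := if l then g else g^-1%g.
  have -> : [seq (if l then Y g else Y g^-1%g) | l <- w] = map Y (map lab w).
    by rewrite -map_comp; apply: eq_map => -[].
  move=> nbal; rewrite cumulants ?kap0 //; last by rewrite /nilp size_map size_eq0.
  apply: contra nbal => /andP[alt ch].
  have -> : sorted (fun l l' => l != l') w.
    move: alt; rewrite /alternating sorted_map; apply: sub_sorted => l l' /=.
    by case: l; case: l' => //=; rewrite ?invgK ?(eq_sym _ g) (negPf gV).
  rewrite andbT; case: w w0 alt ch {cumulants} => // l w _ /alternating_cons[-> _] /=.
  rewrite size_map negbK; case: odd => // lab1; case/negP: g1; move: lab1.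
  by case: l => //=; rewrite invg_eq1.
rewrite -map_nseq cumulants ?kap0 // ?/nilp ?size_nseq; last by case: m mo.
rewrite /balanced; apply/nandP; right.
have -> : charge (nseq m g) = (g ^+ m)%g.
  elim: (m) => [|k IH]; first by rewrite /charge big_nil.
  by rewrite /= charge_cons IH expgSr.
have gg : (g * g = 1)%g by rewrite {2}gV mulgV.
rewrite -(odd_double_half m) mo add1n expgS -mul2n expgM expgS expg1 gg expg1n mulg1.
exact: g1.
Qed.
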